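(* Let $G=\langle X|R\rangle$ be a finitely presented group (with $X$ and $R$ finite), $H$ a finitely generated subgroup of $G$ and $\rho:G\to G/H$ the natural projection. Let $A\subseteq G/H$ be a finite subset such that $\rho^{-1}(A)$ is connected in the Cayley graph $Cay(G,X)$, and suppose that there exists a finite subset $B$ of $G/H$ with the following property: for any simple closed path $\gamma$ in $Cay(G,X)$ all of whose vertices lie in $\rho^{-1}(A)$ there exists a disk van Kampen diagram $\Omega$ over $(X,R)$, with vertices labeled by elements of $G$, such that $\partial\Omega=\gamma$ and (the labels of) all vertices of $\Omega$ lie in $\rho^{-1}(B)$. Then $H$ is finitely presented.
   Context: $Cay(G,X)$ is the left Cayley graph: its vertex set is $G$ and for all $g\in G$, $x\in X$ there is an oriented edge from $g$ to $xg$ labeled by $x$. A set of vertices is connected if it is nonempty and the subgraph it spans is connected. Elements of $R$ are cyclically reduced words. Paths may traverse edges in either direction; the label of a path traversing edges $e_1,\dots,e_k$ in this order is $l(e_k)^{\varepsilon_k}\cdots l(e_1)^{\varepsilon_1}$, where $l(e)$ is the label of $e$ and $\varepsilon_i=1$ or $-1$ according to whether $e_i$ is traversed in the positive or negative direction. Let $\Omega$ be a finite connected oriented plane graph with edges labeled by elements of $X$. Its cells are the bounded connected components of $\mathbb R^2\setminus\Omega$; boundary labels of cells are read as labels of closed paths (up to cyclic shift and inversion). $\Omega$ is a van Kampen diagram over $(X,R)$ if the boundary label of every cell is a cyclic shift of an element of $R\cup R^{-1}$. If $\mathcal U$ is the unbounded component of $\mathbb R^2\setminus\Omega$, then $\partial\Omega$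 denotes $\partial\mathcal U$, and $\Omega$ is a disk diagram if $\mathbb R^2\setminus\mathcal U$ is homeomorphic to a closed disk. The vertices of $\Omega$ are labeled by elements of $G$ so that $l(w)=l(e)l(v)$ whenever $e$ is an edge from $v$ to $w$. The equality $\partial\Omega=\gamma$ means that there exist a vertex $v$ of $\partial\Omega$ and a vertex $g\in G$ of $\gamma$ such that $l(v)=g$ and the labels of $\partial\Omega$ (read starting from $v$) and of $\gamma$ (read starting from $g$) coincide. *)

(* Defs.v *)
From HB Require Import structures.
From mathcomp Require Import all_boot all_order all_algebra.
From mathcomp Require Import all_classical all_reals all_analysis.
Import Order.TTheory GRing.Theory Num.Theory.
Import numFieldNormedType.Exports.

Set Implicit Arguments.
Unset Strict Implicit.
Unset Printing Implicit Defensive.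

Local Open Scope classical_set_scope.
Local Open Scope ring_scope.

(* A letter (x, true) stands for x and (x, false) for the inverse of x. *)
Notation letter X := (X * bool)%type (only parsing).
Notation word X := (seq (X * bool)) (only parsing).

Definition linv (X : Type) (a : letter X) : letter X := (a.1, ~~ a.2).
Definition winv (X : Type) (w : word X) : word X := rev (map (@linv X) w).

Definition cyclically_reduced (X : eqType) (w : word X) : bool :=
  cycle (fun a b : letter X => b != linv a) w.

(* The congruence on words whose quotient is the group < X | rels >. *)
Inductive pres_eq (X : eqType) (rels : seq (word X)) : word X -> word X -> Prop :=
| pres_refl w : pres_eq rels w w
| pres_sym v w : pres_eq rels v w -> pres_eq rels w v
| pres_trans u v w : pres_eq rels u v -> pres_eq rels v w -> pres_eq rels u w
| pres_cancel u a v : pres_eq rels (u ++ [:: a; linv a] ++ v) (u ++ v)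
| pres_relator u r v : r \in rels ->
    pres_eq rels (u ++ r ++ v) (u ++ v).

Section Groups.
Local Open Scope group_scope.
Variable G : groupType.

Definition leval (X : Type) (f : X -> G) (a : letter X) : G :=
  if a.2 then f a.1 else (f a.1)^-1.
Definition weval (X : Type) (f : X -> G) (w : word X) : G :=
  \prod_(a <- w) leval f a.

Definition generated_by (K : set G) (X : Type) (f : X -> G) : Prop :=
  range (weval f) = K.

(* K = < X | rels >, the generator x being realized by the element f x of K. *)
Definition presented_by (K : set G) (X : eqType) (f : X -> G)
    (rels : seq (word X)) : Prop :=
  generated_by K f /\ forall w, weval f w = 1 <-> pres_eq rels w [::].

Definition finitely_generated (K : set G) : Prop :=
  exists (X : finType) (f : X -> G), generated_by K f.

Definition finitely_presented (K : set G) : Prop :=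
  exists (X : finType) (f : X -> G) (rels : seq (word X)),
    presented_by K f rels.

Definition rho (H : set G) (g : G) : set G := [set g * h | h in H].
Definition cosets (H : set G) : set (set G) := range (rho H).

End Groups.

Section Graphs.
Variable X : Type.

Record lgraph := LGraph {
  vertex : eqType;
  edge : eqType;
  src : edge -> vertex;
  tgt : edge -> vertex;
  lab : edge -> X }.

(* A dart is an edge with a direction of traversal, positive for true. *)
Notation dart L := (edge L * bool)%type.

Variable L : lgraph.

Definition dsrc (d : dart L) : vertex L := if d.2 then src d.1 else tgt d.1.
Definition dtgt (d : dart L) : vertex L := if d.2 then tgt d.1 else src d.1.

Fixpoint is_path (u : vertex L) (p : seq (dart L)) (v : vertex L) : Prop :=
  if p is d :: p' then dsrc d = u /\ is_path (dtgt d) p' v else u = v.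

(* The letter of the last traversed edge comes first. *)
Definition path_label (p : seq (dart L)) : word X :=
  rev [seq (lab d.1, d.2) | d <- p].

Definition closed_path (v : vertex L) (p : seq (dart L)) : Prop :=
  p <> [::] /\ is_path v p v.

(* The condition on edges only excludes an edge followed by its reverse. *)
Definition simple_closed_path (v : vertex L) (p : seq (dart L)) : Prop :=
  [/\ closed_path v p, uniq (map dsrc p) & uniq [seq d.1 | d <- p]].

Definition path_in (S : set (vertex L)) (p : seq (dart L)) : Prop :=
  forall d : dart L, d \in p -> S (dsrc d) /\ S (dtgt d).

Definition connected_vertices (S : set (vertex L)) : Prop :=
  S !=set0 /\
  forall u v, S u -> S v -> exists p, is_path u p v /\ path_in S p.

End Graphs.

Notation dart L := (edge L * bool)%type.

Definition Cay (G : groupType) (X : eqType) (f : X -> G) : lgraph X :=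
  @LGraph X G (G * X)%type (fun e => e.1) (fun e => (f e.2 * e.1)%g)
    (fun e => e.2).

Section Plane.
Variable R : realType.

Definition closed_disk : set (R * R) := [set z | z.1 ^+ 2 + z.2 ^+ 2 <= 1].
Definition open_disk : set (R * R) := [set z | z.1 ^+ 2 + z.2 ^+ 2 < 1].
Definition circle (t : R) : R * R := (cos (2 * pi * t), sin (2 * pi * t)).

Definition homeomorphic (A B : set (R * R)) : Prop :=
  exists f g : R * R -> R * R,
    [/\ {within A, continuous f}, {within B, continuous g},
        f @` A `<=` B, g @` B `<=` A &
        (forall x, A x -> g (f x) = x) /\ (forall y, B y -> f (g y) = y)].

Definition frontier (A : set (R * R)) : set (R * R) :=
  closure A `\` interior A.

Variable X : Type.

(* A finite connected plane graph: the edge e is drawn as the arc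
   (epos e) @` `[0, 1]; loops and multiple edges are allowed. *)
Record plane_graph := PlaneGraph {
  pgraph :> lgraph X;
  vpos : vertex pgraph -> R * R;
  epos : edge pgraph -> R -> R * R;
  finite_vertices : finite_set [set: vertex pgraph];
  finite_edges : finite_set [set: edge pgraph];
  graph_connected : connected_vertices [set: vertex pgraph];
  vpos_inj : injective vpos;
  epos_continuous : forall e, {within `[0, 1], continuous (epos e)};
  epos_src : forall e, epos e 0 = vpos (src e);
  epos_tgt : forall e, epos e 1 = vpos (tgt e);
  epos_vpos : forall e t v, 0 < t < 1 -> epos e t <> vpos v;
  epos_inj : forall e e' t t', 0 < t < 1 -> 0 < t' < 1 ->
    epos e t = epos e' t' -> e = e' /\ t = t' }.

Variable O : plane_graph.

Definition dpos (d : dart O) (t : R) : R * R :=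
  epos d.1 (if d.2 then t else 1 - t).

Definition path_support (p : seq (dart O)) : set (R * R) :=
  \bigcup_(d in [set d : dart O | d \in p]) (dpos d @` `[0, 1]).

Definition drawing : set (R * R) :=
  range (@vpos O) `|` \bigcup_(e in [set: edge O]) (epos e @` `[0, 1]).

Definition faces : set (set (R * R)) :=
  [set connected_component (~` drawing) z | z in ~` drawing].
Definition cells : set (set (R * R)) :=
  [set C | faces C /\ bounded_set C].

(* Exactly one component of the complement is unbounded. *)
Definition outer : set (R * R) :=
  \bigcup_(C in [set C | faces C /\ ~ bounded_set C]) C.

(* p runs once around the boundary of the cell C: the cell is parametrized by
   a map of the closed disk which is bijective from the open disk to C and
   sends the i-th of (size p) equal arcs of the unit circle along the i-th dart
   of p.  Every cell of a finite connected plane graph has such a path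
   (Caratheodory), unique up to cyclic shift and inversion. *)
Definition cell_boundary (C : set (R * R)) (p : seq (dart O)) : Prop :=
  (exists v, closed_path v p) /\
  exists phi : R * R -> R * R,
    [/\ {within closed_disk, continuous phi},
        set_bij open_disk C phi &
        forall (i : 'I_(size p)) (s : R), 0 <= s <= 1 ->
          phi (circle ((i%:R + s) / (size p)%:R)) = dpos (tnth (in_tuple p) i) s].

(* p runs once around the boundary of the unbounded component; for a disk
   diagram this boundary is a simple closed curve. *)
Definition outer_boundary (v : vertex O) (p : seq (dart O)) : Prop :=
  simple_closed_path v p /\ path_support p = frontier outer.

Definition disk_diagram : Prop := homeomorphic closed_disk (~` outer).

End Plane.

Definition van_kampen (R : realType) (X : eqType) (rels : seq (word X))
    (O : plane_graph R X) : Prop :=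
  forall C, cells O C -> exists p : seq (dart O), cell_boundary C p /\
    exists r k, r \in rels /\
      (path_label p = rot k r \/ path_label p = rot k (winv r)).

Definition vertex_labeling (R : realType) (X : eqType) (G : groupType)
    (f : X -> G) (O : plane_graph R X) (l : vertex O -> G) : Prop :=
  forall e : edge O, l (tgt e) = (f (lab e) * l (src e))%g.

(* The equality of the boundary of O with the closed path c of Cay(G, X). *)
Definition boundary_eq (R : realType) (X : eqType) (G : groupType)
    (f : X -> G) (O : plane_graph R X) (l : vertex O -> G)
    (c : seq (dart (Cay f))) : Prop :=
  exists (v : vertex O) (p : seq (dart O)) (k : nat) (g : G),
    [/\ outer_boundary v p, closed_path (L := Cay f) g (rot k c), l v = g &
        path_label p = path_label (rot k c)].

(* Main.v *)
From HB Require Import structures.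
Require Import Defs.
From mathcomp Require Import all_boot all_order all_algebra.
From mathcomp Require Import generic_quotient.
From mathcomp Require Import all_classical all_reals all_analysis.
From mathcomp Require Import ring lra zify.
Import Order.TTheory GRing.Theory Num.Theory.
Import numFieldNormedType.Exports.

(** The set [rho H @^-1` (A `|` B)] is a union of finitely many cosets [g H],
    and [H] acts on it freely by right translation, so the part of the Cayley
    complex of [G] that it spans has a finite quotient by [H].  Choose a
    representative [rep K] of every coset [K] and write [g = rep (g H) * hpart g].
    An edge from [g] to [f x * g] over [A `|` B] is labelled by the pair of the
    coset of [g] and [x]; this label determines the element
    [hpart (f x * g) * (hpart g)^-1] of [H], and there are finitely many labels.
    They are the generators.  The relators are all words of length at most [N] in
    these generators that are trivial in [H], for a large [N].

    Generation ([A_path_exists]): [rho H @^-1` A] is connected, so it contains a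
    path from a base vertex to its translate by any [h] in [H], and the product
    of the labels along this path telescopes to [h].

    Relations ([schreier_presentation]): let [P] be the presented group.  The
    relators include the expression of every generator as the label of a path over
    [A], so each word equals in [P] the label of a path over [A]
    ([word_path]), closed if the word is trivial in [H].  Cutting at repeated
    vertices and cancelling backtracks reduces closed paths to simple ones
    ([closed_holonomy_trivial]), which bound disk diagrams over [B].  The labels
    around a cell of such a diagram form a short word that is trivial in [H],
    because the [hpart]s telescope, hence they are trivial in [P].

    It remains to see that a [P]-valued weight on the edges of a disk diagram that
    is trivial around each cell is trivial along all closed paths, which is
    [disk_diagram_potential]: such a weight is a coboundary.  This is where the
    topology of the plane enters.  The closed region [D] covered by the diagram
    is a disk, hence it carries only trivial flat [P]-bundles.  Flat bundles are
    handled as transport functions [T z z'] with values in [P], of which only the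
    values at nearby points matter and which near each point are coboundaries
    [s z' * (s z)^-1].  On a disk such a [T] is a coboundary at small scale, with
    the potential at [x] obtained by transport along the ray from the center
    ([disk_potential]).  The weight gives a transport on the drawn graph that
    jumps by the weight of an edge at its midpoint ([jump]), and the characteristic
    map of a cell extends it over the cell, because it is trivial along the
    boundary ([cell_chart]).

    A plane graph may a priori have infinitely many cells, which accumulate on the
    graph.  In [transport] a cell that stays within a small distance of the graph
    gets the transport of nearby points of the graph, and the other cells, which
    reach further away, are finitely many by compactness of [D]. *)

Set Implicit Arguments.
Unset Strict Implicit.
Unset Printing Implicit Defensive.
Local Open Scope classical_set_scope.

(** * Uniformity on compact sets *)

Section Uniform.
Local Open Scope ring_scope.
Variables (R : realType) (V : pseudoMetricNormedZmodType R).

(** The uniformity principle behind all later choices of radii: a condition on a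
    point and a radius that weakens as the radius shrinks, and that holds with one
    radius near each point of a compact set, holds with one radius on the set. *)
Lemma compact_uniform (K : set V) (M : V -> R -> Prop) :
  compact K ->
  (forall x r r', 0 < r' -> r' <= r -> M x r -> M x r') ->
  (forall x, K x ->
     exists2 r, 0 < r & forall y, K y -> `|y - x| < r -> M y r) ->
  exists2 r, 0 < r & forall x, K x -> M x r.
Proof.
move=> /compact_near_coveringP/near_covering_withinP cK anti loc.
have /= := cK _ (0^'+ : set_system R) (fun r x => M x r) _.
case=> [x Kx|].
  have [r r0 Mr] := loc _ Kx.
  near=> y s => Ky; apply: (anti _ r) => /=.
  - by near: s; exact: nbhs_right_gt.
  - by apply: ltW; near: s; exact: nbhs_right_lt.
  apply: Mr => //; near: y; apply/nbhs_ballP; exists r.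
move=> r /= r0 Hr; exists (r / 2); first by rewrite divr_gt0.
apply: Hr => //=; last by rewrite divr_gt0.
by rewrite sub0r normrN gtr0_norm ?divr_gt0// gtr_pMr// invf_lt1 ?ltr1n.
Unshelve. all: by end_near. Qed.

Lemma finite_uniform (I : eqType) (E : set I) (M : I -> R -> Prop) :
  finite_set E ->
  (forall i r r', 0 < r' -> r' <= r -> M i r -> M i r') ->
  (forall i, E i -> exists2 r, 0 < r & M i r) ->
  exists2 r, 0 < r & forall i, E i -> M i r.
Proof.
move=> /finite_seqP[s ->] anti; elim: s => [|i s IH] H; first by exists 1.
case: IH => [j js|r r0 Hr]; first by apply: H; rewrite /= inE js orbT.
have [|r' r'0 Hr'] := H i; first by rewrite /= mem_head.
have m0 : 0 < Num.min r r' by rewrite lt_min r0.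
exists (Num.min r r') => // j; rewrite /= inE => /orP[/eqP->|js].
  by apply: (anti _ r') => //; rewrite ge_min lexx orbT.
by apply: (anti _ r); rewrite ?ge_min ?lexx//; exact: Hr.
Qed.

Lemma within_near (W : pseudoMetricNormedZmodType R) (A : set V) (f : V -> W) :
  {within A, continuous f} -> forall x e, A x -> 0 < e ->
  exists2 d, 0 < d & forall y, A y -> `|y - x| < d -> `|f y - f x| < e.
Proof.
move=> /subspace_continuousP cf x e Ax e0.
have /cvgr_dist_lt/(_ _ e0) := cf _ Ax.
rewrite near_withinE => /nbhs_ballP[d /= d0 Hd]; exists d => // y Ay yx.
rewrite distrC; apply: Hd => //.
by rewrite -ball_normE /= distrC.
Qed.

Lemma compact_gap (W : pseudoMetricNormedZmodType R) (K A : set V)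
    (u : V -> W) (w : W) :
  compact K -> K `<=` A -> {within A, continuous u} ->
  (forall x, K x -> u x <> w) ->
  exists2 r, 0 < r & forall x, K x -> r <= `|u x - w|.
Proof.
move=> cK KA cu uw; apply: (compact_uniform cK).
  by move=> x r r' _ rr'; exact: le_trans.
move=> x Kx; have e0 : 0 < `|u x - w| / 2.
  by rewrite divr_gt0// normr_gt0 subr_eq0; apply/eqP/uw.
have [d d0 Hd] := within_near cu (KA _ Kx) e0.
have m0 : 0 < Num.min d (`|u x - w| / 2) by rewrite lt_min d0.
exists (Num.min d (`|u x - w| / 2)) => // y Ky.
rewrite lt_min => /andP[/(Hd _ (KA _ Ky)) yx _]; rewrite ge_min.
apply/orP; right; have := ler_distD (u y) (u x) w; rewrite (distrC (u x) (u y)).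
by lra.
Qed.

Lemma compact_uniform_continuity (W : pseudoMetricNormedZmodType R) (K : set V)
    (f : V -> W) e :
  compact K -> {within K, continuous f} -> 0 < e ->
  exists2 d, 0 < d &
    forall x y, K x -> K y -> `|y - x| < d -> `|f y - f x| < e.
Proof.
move=> cK cf e0.
have [|x Kx|d d0 Hd] := @compact_uniform K
  (fun x d => forall y, K y -> `|y - x| < d -> `|f y - f x| < e) cK.
- by move=> x r r' _ rr' H y Ky yx; apply: H => //; exact: lt_le_trans rr'.
- have [|d d0 Hd] := within_near cf Kx (e := e / 2); first by rewrite divr_gt0.
  exists (d / 2); first by rewrite divr_gt0.
  move=> y Ky yx z Kz zy; have yx' : `|f y - f x| < e / 2 by apply: Hd => //; lra.
  have zx' : `|f z - f x| < e / 2.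
    by apply: Hd => //; have := ler_distD y z x; lra.
  by have := ler_distD (f x) (f z) (f y); rewrite (distrC (f x)); lra.
- by exists d => // x y Kx Ky; exact: Hd.
Qed.

Lemma lebesgue_number (K : set V) (Q : set V -> Prop) :
  compact K -> (forall A B : set V, B `<=` A -> Q A -> Q B) ->
  (forall x, K x -> exists2 r, 0 < r & Q [set y | `|y - x| < r]) ->
  exists2 r, 0 < r & forall x, K x -> Q [set y | `|y - x| < r].
Proof.
move=> cK anti loc; apply: (compact_uniform cK).
  by move=> x r r' _ rr'; apply: anti => y /= /lt_le_trans; exact.
move=> x /loc[r r0 Qr]; exists (r / 2); first by rewrite divr_gt0.
move=> y _ yx; apply: anti Qr => z /= zy.
by have := ler_distD y z x; lra.
Qed.

End Uniform.

Section Subdivision.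
Local Open Scope ring_scope.

Lemma small_step (R : realType) (r : R) : 0 < r ->
  exists2 N : nat, (0 < N)%N & N%:R^-1 < r.
Proof.
move=> r0; exists (Num.truncn r^-1).+1 => //.
have /truncn_itv/andP[_ h] : 0 <= r^-1 by rewrite invr_ge0 ltW.
by rewrite invf_plt// posrE ltr0n.
Qed.

Lemma locally_constant_interval (R : realType) (T : Type) (F : R -> T) :
  (forall t, 0 <= t <= 1 -> exists2 r, 0 < r &
     forall t', 0 <= t' <= 1 -> `|t' - t| < r -> F t' = F t) ->
  F 0 = F 1.
Proof.
move=> loc.
have [t|t|r r0 Hr] := @compact_uniform R R `[0, 1]
  (fun t r => forall t', 0 <= t' <= 1 -> `|t' - t| < r -> F t' = F t)
  (@segment_compact R 0 1).
- by move=> r r' _ rr' H t' ti tr; apply: H => //; exact: lt_le_trans rr'.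
- rewrite /= in_itv/= => ti; have [r r0 Hr] := loc _ ti.
  exists (r / 2); first by rewrite divr_gt0.
  move=> s; rewrite in_itv/= => si st t' ti' ts.
  rewrite [RHS]Hr; [|lra|lra]; apply: Hr => //.
  by have := ler_distD s t' t; lra.
have [N N0 Nr] := small_step r0.
have Np : 0 < N%:R :> R by rewrite ltr0n.
have Fk k : (k <= N)%N -> F (k%:R / N%:R) = F 0.
  elim: k => [|k IH] kN; first by rewrite mul0r.
  have k01 j : (j <= N)%N -> 0 <= (j%:R / N%:R : R) <= 1.
    by move=> jN; rewrite divr_ge0//= ler_pdivrMr// mul1r ler_nat.
  rewrite -IH 1?ltnW//; apply: (Hr (k%:R / N%:R)).
  - by rewrite /= in_itv/=; apply: k01; exact: ltnW.
  - exact: k01.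
  - by rewrite -mulrBl -natrB// subSnn mul1r ger0_norm// invr_ge0 ltW.
by rewrite -(Fk N)// divff// gt_eqF.
Qed.

End Subdivision.

(** * Holonomy along paths *)

Section Holonomy.
Variables (X : Type) (L : lgraph X) (P : groupType) (w : edge L -> P).
Local Open Scope group_scope.

Definition dart_weight (d : dart L) : P := if d.2 then w d.1 else (w d.1)^-1.

(** The weight of the last traversed dart is the leftmost factor, as in
   [path_label]. *)
Definition holonomy (p : seq (dart L)) : P := \prod_(d <- rev p) dart_weight d.

Lemma holonomy_nil : holonomy [::] = 1.
Proof. exact: big_nil. Qed.

Lemma holonomy_cat p q : holonomy (p ++ q) = holonomy q * holonomy p.
Proof. by rewrite /holonomy rev_cat big_cat. Qed.

Lemma holonomy_cons d p : holonomy (d :: p) = holonomy p * dart_weight d.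
Proof. by rewrite -cat1s holonomy_cat /holonomy big_seq1. Qed.

Lemma holonomy_rcons p d : holonomy (rcons p d) = dart_weight d * holonomy p.
Proof. by rewrite -cats1 holonomy_cat /holonomy big_seq1. Qed.

End Holonomy.

Lemma not_uniq_map (T U : eqType) (h : T -> U) (p : seq T) : ~~ uniq (map h p) ->
  exists p1 d p2 d' p3, h d = h d' /\ p = p1 ++ d :: p2 ++ d' :: p3.
Proof.
elim: p => [//|d p IH] /=; rewrite negb_and negbK => /orP[/mapP[d' d'p dd']|/IH].
  by case/splitPr: d'p => p2 p3; exists [::], d, p2, d', p3.
by move=> [p1 [a [p2 [b [p3 [ab ->]]]]]]; exists (d :: p1), a, p2, b, p3.
Qed.

Section Paths.
Local Open Scope group_scope.
Variables (X : Type) (L : lgraph X).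
Implicit Types (d : dart L) (p q : seq (dart L)) (u v : vertex L).

Definition drev d : dart L := (d.1, ~~ d.2).
Definition path_rev p := rev (map drev p).

Lemma dsrc_drev d : dsrc (drev d) = dtgt d. Proof. by case: d => e []. Qed.
Lemma dtgt_drev d : dtgt (drev d) = dsrc d. Proof. by case: d => e []. Qed.

Lemma is_path_cat u v p q :
  is_path u (p ++ q) v <-> exists2 m, is_path u p m & is_path m q v.
Proof.
elim: p u => [|d p IH] u /=.
  by split=> [uv|[m -> //]]; exists u.
by split=> [[du /IH[m]]|[m [du pm] qv]]; [exists m|split=> //; apply/IH; exists m].
Qed.

Lemma is_path_rev u v p : is_path u p v -> is_path v (path_rev p) u.
Proof.
elim: p u => [|d p IH] u /=; first by move=> ->.
move=> [du /IH pv]; rewrite /path_rev /= rev_cons -cats1; apply/is_path_cat.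
by exists (dtgt d) => //=; rewrite dsrc_drev dtgt_drev.
Qed.

Lemma path_in_rev (S : set (vertex L)) p : path_in S p -> path_in S (path_rev p).
Proof.
move=> pS d; rewrite mem_rev => /mapP[d' /pS[? ?] ->].
by rewrite dsrc_drev dtgt_drev.
Qed.

Variables (P : groupType).

Lemma dart_weight_rev (w : edge L -> P) d : dart_weight w (drev d) = (dart_weight w d)^-1.
Proof. by case: d => e []; rewrite /dart_weight/= ?invgK. Qed.

Lemma holonomy_rev (w : edge L -> P) p : holonomy w (path_rev p) = (holonomy w p)^-1.
Proof.
elim: p => [|d p IH]; first by rewrite holonomy_nil invg1.
by rewrite /path_rev/= rev_cons holonomy_rcons -/(path_rev p) IH holonomy_cons dart_weight_rev invgM.
Qed.

(** A weight that is a coboundary along the darts of a path has a product that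
    depends on the endpoints only. *)
Lemma holonomy_telescope (w : edge L -> P) (sigma : vertex L -> P) u p v :
  (forall d, d \in p -> dart_weight w d = sigma (dtgt d) * (sigma (dsrc d))^-1) ->
  is_path u p v -> holonomy w p = sigma v * (sigma u)^-1.
Proof.
elim: p u => [|d p IH] u wd /=; first by move=> ->; rewrite holonomy_nil mulgV.
move=> [<- pv]; rewrite holonomy_cons (IH (dtgt d))//; last first.
  by move=> d' d'p; apply: wd; rewrite inE d'p orbT.
by rewrite wd ?mem_head// mulgA mulgVK.
Qed.

Lemma dart_weight_potential (w : edge L -> P) (sigma : vertex L -> P) d :
  w d.1 = sigma (tgt d.1) * (sigma (src d.1))^-1 ->
  dart_weight w d = sigma (dtgt d) * (sigma (dsrc d))^-1.
Proof. by case: d => e [] /= we; rewrite /dart_weight/= we// invgM invgK. Qed.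

Definition relabel (Y : Type) (y : edge L -> Y) p : word Y :=
  rev [seq (y d.1, d.2) | d <- p].

Lemma holonomy_relabel (Y : Type) (y : edge L -> Y) (h : Y -> P) p :
  holonomy (h \o y) p = weval h (relabel y p).
Proof. by rewrite /relabel -map_rev /weval big_map. Qed.

(** A closed path that visits a vertex twice splits there into two shorter closed
    paths; one that visits no vertex twice but uses an edge twice uses it in both
    directions, and dropping these two darts leaves two shorter closed paths. *)
Lemma closed_holonomy_trivial (w : edge L -> P) (S : set (vertex L)) :
  (forall u p, simple_closed_path u p -> path_in S p -> holonomy w p = 1) ->
  forall u p, is_path u p u -> path_in S p -> holonomy w p = 1.
Proof.
move=> simple u p; have [n] := ubnP (size p); elim: n => // n IH in u p *.
rewrite ltnS => pn pu pS.
have sub q : {subset q <= p} -> path_in S q by move=> qp d /qp; exact: pS.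
case pE: p => [|d0 p0]; first by rewrite holonomy_nil.
rewrite -pE; have pn0 : p <> [::] by rewrite pE.
have [us|] := boolP (uniq (map (@dsrc _ L) p)); last first.
  move=> /not_uniq_map[p1 [d [p2 [d' [p3 [dd' pE']]]]]].
  rewrite {}pE' in pu pn sub *.
  have [m p1m] := (is_path_cat _ _ _ _).1 pu.
  rewrite -cat_cons => /is_path_cat[m' [dm p2m'] [dm' p3u]].
  have hol2 : holonomy w (d :: p2) = 1.
    apply: (IH (dsrc d)); last by apply: sub => x; rewrite mem_cat -cat_cons mem_cat => ->; rewrite orbT.
      by move: pn; rewrite !size_cat /= size_cat /=; lia.
    by split=> //; rewrite dd' dm'.
  have hol13 : holonomy w (p1 ++ d' :: p3) = 1.
    apply: (IH u).
    - by move: pn; rewrite !size_cat /= size_cat /=; lia.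
    - by apply/is_path_cat; exists m => //; split=> //; rewrite -dd'.
    - apply: sub => x; rewrite !mem_cat => /orP[->//|xp].
      by rewrite inE mem_cat xp !orbT.
  by rewrite !holonomy_cat hol2 mulg1 -holonomy_cat.
have [ue|] := boolP (uniq [seq d.1 | d <- p]); first by apply: (simple u).
move=> /not_uniq_map[p1 [d [p2 [d' [p3 [dd' pE']]]]]].
have rd : d' = drev d.
  case: (eqVneq d.2 d'.2) => [bb|nb].
    have dE : d = d' by rewrite (surjective_pairing d) dd' bb -surjective_pairing.
    move: us; rewrite pE' dE map_cat /= map_cat /= cat_uniq /= mem_cat /= inE eqxx.
    by rewrite orbT /= !andbF.
  by rewrite /drev dd' (surjective_pairing d'); move: nb; case: d.2; case: d'.2.
rewrite {}pE' in pu pn sub *.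
have [m p1m] := (is_path_cat _ _ _ _).1 pu.
move=> [dm /is_path_cat[m' p2m' [dm' p3u]]].
rewrite rd dsrc_drev in dm'; rewrite rd dtgt_drev in p3u.
have hol2 : holonomy w p2 = 1.
  apply: (IH (dtgt d)).
  - by move: pn; rewrite !size_cat /= size_cat /=; lia.
  - by rewrite {2}dm'.
  - by apply: sub => x xp; rewrite mem_cat inE mem_cat xp !orbT.
have hol13 : holonomy w (p1 ++ p3) = 1.
  apply: (IH u).
  - by move: pn; rewrite !size_cat /= size_cat /=; lia.
  - by apply/is_path_cat; exists m => //; rewrite -dm.
  - apply: sub => x; rewrite !mem_cat => /orP[->//|xp].
    by rewrite inE mem_cat inE xp !orbT.
rewrite holonomy_cat holonomy_cons holonomy_cat hol2 mulg1 holonomy_cons rd.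
by rewrite dart_weight_rev mulgVK -holonomy_cat.
Qed.

End Paths.

(** * The group defined by a presentation *)

Section Words.
Local Open Scope group_scope.
Variables (G : groupType) (Y : eqType) (f : Y -> G).

Lemma weval_nil : weval f [::] = 1. Proof. exact: big_nil. Qed.

Lemma weval_cons a u : weval f (a :: u) = leval f a * weval f u.
Proof. exact: big_cons. Qed.

Lemma weval_cat u v : weval f (u ++ v) = weval f u * weval f v.
Proof. exact: big_cat. Qed.

Lemma leval_linv a : leval f (linv a) = (leval f a)^-1.
Proof. by case: a => y []; rewrite /leval /linv/= ?invgK. Qed.

Lemma pres_eq_weval (rels : seq (word Y)) u v :
  (forall r, r \in rels -> weval f r = 1) ->
  pres_eq rels u v -> weval f u = weval f v.
Proof.
move=> rels1; elim=> {u v} //.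
- by move=> u v w _ -> _ ->.
- by move=> u a v; rewrite !weval_cat !weval_cons leval_linv weval_nil mulg1 mulgV mul1g.
- by move=> u r v /rels1 r1; rewrite !weval_cat r1 mul1g.
Qed.
End Words.

Section PresentedGroup.
Local Open Scope group_scope.
Local Open Scope quotient_scope.
Variables (Y : choiceType) (rels : seq (word Y)).

Lemma pres_eq_ctx a b u v : pres_eq rels u v -> pres_eq rels (a ++ u ++ b) (a ++ v ++ b).
Proof.
elim=> {u v} [u|u v _ IH|u v w _ IH1 _ IH2|u c v|u r v rr].
- exact: pres_refl.
- exact: pres_sym.
- exact: pres_trans IH1 IH2.
- rewrite -!catA (catA a u) (catA a u) ; exact: pres_cancel.
- rewrite -!catA (catA a u) (catA a u); exact: pres_relator.
Qed.

Definition pres_eqb (u v : word Y) : bool := `[< pres_eq rels u v >].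

Lemma pres_eqb_refl : reflexive pres_eqb.
Proof. by move=> u; apply/asboolP; exact: pres_refl. Qed.

Lemma pres_eqb_sym : symmetric pres_eqb.
Proof. by move=> u v; apply/asboolP/asboolP; exact: pres_sym. Qed.

Lemma pres_eqb_trans : transitive pres_eqb.
Proof. by move=> v u w /asboolP uv /asboolP vw; apply/asboolP; exact: pres_trans vw. Qed.

Canonical pres_equiv := EquivRel pres_eqb pres_eqb_refl pres_eqb_sym pres_eqb_trans.

Definition presented := {eq_quot pres_equiv}.
HB.instance Definition _ := Choice.on presented.

Definition pclass (u : word Y) : presented := \pi_({eq_quot pres_equiv}) u.

Lemma pclassP u v : pclass u = pclass v <-> pres_eq rels u v.
Proof. by split=> [/eqmodP/asboolP|uv]; last by apply/eqmodP/asboolP. Qed.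

Definition pmul (x y : presented) : presented := pclass (repr x ++ repr y).
Definition pinv (x : presented) : presented := pclass (winv (repr x)).

Lemma pclass_repr x : pclass (repr x) = x. Proof. exact: reprK. Qed.

Lemma pclass_cat u v : pclass (u ++ v) = pmul (pclass u) (pclass v).
Proof.
apply/pclassP; apply: (pres_trans (v := repr (pclass u) ++ v)).
  by apply: (pres_eq_ctx [::] v); apply/pclassP; rewrite pclass_repr.
have : pres_eq rels v (repr (pclass v)) by apply/pclassP; rewrite pclass_repr.
by move/(pres_eq_ctx (repr (pclass u)) [::]); rewrite !cats0.
Qed.

Lemma pmulA : associative pmul.
Proof.
move=> x y z; rewrite -(pclass_repr x) -(pclass_repr y) -(pclass_repr z).
by rewrite -!pclass_cat catA.
Qed.

Lemma pmul1 : left_id (pclass [::]) pmul.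
Proof. by move=> x; rewrite -(pclass_repr x) -pclass_cat. Qed.

Lemma pmulr1 : right_id (pclass [::]) pmul.
Proof. by move=> x; rewrite -(pclass_repr x) -pclass_cat cats0. Qed.

Lemma winv_cons (a : letter Y) u : winv (a :: u) = winv u ++ [:: linv a].
Proof. by rewrite /winv/= rev_cons cats1. Qed.

Lemma linvK : involutive (@linv Y).
Proof. by case=> y b; rewrite /linv/= negbK. Qed.

Lemma pmulV : left_inverse (pclass [::]) pinv pmul.
Proof.
move=> x; rewrite /pinv -{2}(pclass_repr x) -pclass_cat; apply/pclassP.
elim: (repr x) => [|a u IH]; first exact: pres_refl.
rewrite winv_cons -catA; apply: pres_trans IH.
have := pres_cancel rels (winv u) (linv a) u; by rewrite linvK.
Qed.

Lemma pmulrV : right_inverse (pclass [::]) pinv pmul.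
Proof.
move=> x; rewrite /pinv -{1}(pclass_repr x) -pclass_cat; apply/pclassP.
elim: (repr x) => [|a u IH]; first exact: pres_refl.
rewrite winv_cons -cat1s catA -(catA _ u) -catA.
apply: pres_trans (pres_cancel rels [::] a [::]).
have := pres_eq_ctx [:: a] [:: linv a] IH; by rewrite !catA.
Qed.

HB.instance Definition _ := isGroup.Build presented pmulA pmul1 pmulr1 pmulV pmulrV.

Definition pgen (y : Y) : presented := pclass [:: (y, true)].

(** A word of value [1] in the presented group is a consequence of the relators. *)
Lemma weval_pgen u : weval pgen u = pclass u.
Proof.
elim: u => [|a u IH]; first by rewrite weval_nil.
rewrite weval_cons IH -cat1s pclass_cat; congr (_ * _).
case: a => y [] //=; apply/esym/(mulgI (pgen y)); rewrite mulgV.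
rewrite -[LHS]pclass_cat; apply/pclassP.
exact: (pres_cancel rels [::] (y, true) [::]).
Qed.

End PresentedGroup.

(** * Polar coordinates in the disk *)

Section Polar.
Local Open Scope ring_scope.
Variable R : realType.
Implicit Types (z : R * R) (u c : R).

Definition sqnorm z : R := z.1 ^+ 2 + z.2 ^+ 2.

Lemma norm_pair_lt z c : (`|z| < c) = (`|z.1| < c) && (`|z.2| < c).
Proof. by rewrite prod_normE gt_max. Qed.

Lemma norm_pair_le z c : (`|z| <= c) = (`|z.1| <= c) && (`|z.2| <= c).
Proof. by rewrite prod_normE ge_max. Qed.

Lemma sqnorm_ge0 z : 0 <= sqnorm z.
Proof. by rewrite addr_ge0// sqr_ge0. Qed.

Lemma sqnorm_norm_le z : sqnorm z <= 1 -> `|z| <= 1.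
Proof.
rewrite /sqnorm norm_pair_le !ler_norml => ?.
by apply/andP; split; apply/andP; split; nra.
Qed.

Lemma sqnorm_norm_lt z c : 0 < c -> `|z| < c -> sqnorm z < 2 * c ^+ 2.
Proof.
rewrite /sqnorm norm_pair_lt !ltr_norml => ? /andP[/andP[? ?] /andP[? ?]].
by nra.
Qed.

Lemma compact_disk c : c <= 1 -> compact [set z | sqnorm z <= c].
Proof.
move=> c1; have cS : compact (`[-1, 1]%classic `*` `[-1, 1]%classic : set (R * R)).
  by apply: compact_setX; exact: segment_compact.
apply: (subclosed_compact _ cS).
  have -> : [set z | sqnorm z <= c] = sqnorm @^-1` [set x | x <= c] by [].
  apply: closed_comp; last exact: closed_le.
  move=> z _; apply: cvgD; rewrite expr2; apply: cvgM;
    first [exact: cvg_fst|exact: cvg_snd].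
move=> z /= zc; have /sqnorm_norm_le : sqnorm z <= 1 by exact: le_trans c1.
by rewrite norm_pair_le !in_itv/= !ler_norml => /andP[-> ->].
Qed.

Definition polarE rho u : R * R := (rho * (circle u).1, rho * (circle u).2).

Lemma polar_coordinates z : exists rho u, [/\ 0 <= rho, 0 <= u < 1,
  rho ^+ 2 = sqnorm z & z = polarE rho u].
Proof.
have p0 := pi_gt0 R; have s0 := sqnorm_ge0 z.
have rE : Num.sqrt (sqnorm z) ^+ 2 = sqnorm z by rewrite sqr_sqrtr.
have r0 : 0 <= Num.sqrt (sqnorm z) by rewrite sqrtr_ge0.
exists (Num.sqrt (sqnorm z)); set r := Num.sqrt _ in rE r0 *.
have [rz|rn0] := eqVneq r 0.
  exists 0; split=> //; first by rewrite lexx ltr01.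
  move: rE; rewrite rz expr0n/= => /esym/eqP; rewrite paddr_eq0 ?sqr_ge0//.
  by rewrite !sqrf_eq0 /polarE !mul0r; case: (z) => a b /= /andP[/eqP-> /eqP->].
have rp : 0 < r by rewrite lt_def rn0.
set c := z.1 / r; have zc : z.1 = r * c by rewrite mulrC divfK.
have cle : -1 <= c <= 1.
  have : c ^+ 2 <= 1.
    by rewrite expr_div_n ler_pdivrMr ?exprn_gt0// mul1r rE lerDl sqr_ge0.
  by move=> c2; apply/andP; split; nra.
have sc : r * sin (acos c) = `|z.2|.
  rewrite sin_acos//; have -> : 1 - c ^+ 2 = (z.2 / r) ^+ 2.
    by rewrite /c !expr_div_n rE /sqnorm; field; rewrite -/(sqnorm z) -rE sqrf_eq0.
  by rewrite sqrtr_sqr normrM normfV (gtr0_norm rp) mulrC divfK.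
have cc : cos (acos c) = c by rewrite acosK// in_itv.
have turn : 2 * pi * (acos c / (2 * pi)) = acos c by rewrite mulrC divfK//; lra.
have a0 := acos_ge0 cle; have a1 := acos_lepi cle.
have [y0|y0] := leP 0 z.2.
  exists (acos c / (2 * pi)); split=> //.
    by rewrite divr_ge0 ?ltr_pdivrMr//; lra.
  rewrite /polarE /circle/= turn cc -zc sc ger0_norm//.
  by case: (z).
exists (1 - acos c / (2 * pi)); split=> //.
  have a2 : 0 < acos c.
    rewrite lt_def a0 andbT; apply: contraTneq y0 => ac.
    move: sc; rewrite ac sin0 mulr0 => /esym/eqP.
    by rewrite normr_eq0 => /eqP ->; rewrite ltxx.
  have q1 : 0 < acos c / (2 * pi) by rewrite divr_gt0//; lra.
  have q2 : acos c / (2 * pi) <= 1 by rewrite ler_pdivrMr; lra.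
  by apply/andP; split; lra.
rewrite /polarE /circle/= mulrBr turn mulr1 mulr_natl addrC.
rewrite cosD2pi sinD2pi cosN sinN cc -zc mulrN sc ltr0_norm// opprK.
by case: (z).
Qed.

(** Nearby points of the outer annulus have nearby angles modulo a full turn: the
    squared distance is
    [(rho - rho')^2 + 2 * rho * rho' * (1 - cos (2 * pi * (u - u')))]. *)
Lemma polar_dist rho rho' u u' : 2^-1 <= rho -> 2^-1 <= rho' ->
  1 - cos (2 * pi * (u - u')) <=
    2 * sqnorm (polarE rho u - polarE rho' u').
Proof.
move=> r1 r2; rewrite mulrBr cosB /sqnorm/=.
set C := cos _; set C' := cos _; set S := sin _; set S' := sin _.
have h1 : C ^+ 2 + S ^+ 2 = 1 by rewrite cos2Dsin2.
have h2 : C' ^+ 2 + S' ^+ 2 = 1 by rewrite cos2Dsin2.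
have h3 : C * C' + S * S' <= 1.
  by have := sqr_ge0 (C - C'); have := sqr_ge0 (S - S'); nra.
have -> : (rho * C - rho' * C') ^+ 2 + (rho * S - rho' * S') ^+ 2 =
  (rho - rho') ^+ 2 + 2 * (rho * rho') * (1 - (C * C' + S * S')).
  transitivity (rho ^+ 2 * (C ^+ 2 + S ^+ 2) + rho' ^+ 2 * (C' ^+ 2 + S' ^+ 2)
    - 2 * (rho * rho') * (C * C' + S * S')); first by ring.
  by rewrite h1 h2; ring.
have h4 : 4^-1 <= rho * rho'.
  have i2 : (0 : R) <= 2^-1 by lra.
  by have := ler_pM i2 i2 r1 r2; lra.
have h5 := sqr_ge0 (rho - rho').
set D := C * C' + S * S' in h3 *.
have : 0 <= (rho * rho' - 4^-1) * (1 - D).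
  by rewrite mulr_ge0// subr_ge0.
lra.
Qed.

Lemma cos_gap (t v : R) : 0 < t -> t <= 2^-1 -> t <= v -> v <= 1 - t ->
  cos (2 * pi * v) <= cos (2 * pi * t).
Proof.
move=> t0 t2 tv v1; have p0 := pi_gt0 R.
have anti x y : 0 <= x -> x <= y -> y <= pi -> cos y <= cos x :> R.
  move=> x0 xy yp; rewrite leNgt ltr_cos -?leNgt// in_itv/=; lra.
have [v2|v2] := leP v 2^-1; first by apply: anti; nra.
have -> : cos (2 * pi * v) = cos (2 * pi * (1 - v)).
  rewrite -[RHS]cosN -[RHS]cosD2pi; congr cos; rewrite -mulr_natl; ring.
by apply: anti; nra.
Qed.

End Polar.

(** * The transport on the drawn graph *)

Section Coboundary.
Local Open Scope ring_scope.

(** [T] is a flat transport that is trivialized over [B]; the points are ordered so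
    that transports compose as [T y z * T x y]. *)
Definition coboundary_on (V : Type) (P : groupType) (T : V -> V -> P) (B : set V) :=
  exists s : V -> P, forall y y', B y -> B y' -> T y y' = (s y' * (s y)^-1)%g.

Definition disc (R : numDomainType) (V : normedZmodType R) (z : V) (r : R) : set V :=
  [set y | `|y - z| < r].

Lemma coboundary_sub (V : Type) (P : groupType) (T : V -> V -> P) (B C : set V) :
  C `<=` B -> coboundary_on T B -> coboundary_on T C.
Proof. by move=> CB [s Ts]; exists s => y y' /CB ? /CB; exact: Ts. Qed.

End Coboundary.

Section Jump.
Local Open Scope ring_scope.
Variables (R : realType) (X : Type) (O : plane_graph R X).
Variables (P : groupType) (w : edge O -> P).
Implicit Types (e : edge O) (d : dart O) (t s : R) (z : R * R).

(** The interior half of an edge.  A transport between two points of the graph is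
    nontrivial only if both lie in this half of one edge, on different sides of its
    midpoint; so near a vertex, and in particular between the two ends of a loop,
    the transport is trivial. *)
Definition mid t : bool := (4^-1 < t < 1 - 4^-1).

(** The transport from the source of [e] to its point at time [t]. *)
Definition phase e t : P := if t < 2^-1 then 1%g else w e.

Definition dart_phase d s : P :=
  if d.2 then phase d.1 s else (phase d.1 (1 - s) * (w d.1)^-1)%g.

Definition jump z z' : P :=
  xget 1%g [set c | exists e t t', [/\ mid t, mid t', epos e t = z,
    epos e t' = z' & c = (phase e t' * (phase e t)^-1)%g]].

Lemma mid01 t : mid t -> 0 < t < 1.
Proof. by rewrite /mid; lra. Qed.

Lemma epos_interior_inj e e' t t' : 0 < t < 1 -> 0 <= t' <= 1 ->
  epos e t = epos e' t' -> e = e' /\ t = t'.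
Proof.
move=> t01 /andP[]; rewrite le_eqVlt => /predU1P[<- _|t0].
  by rewrite epos_src => /(epos_vpos t01).
rewrite le_eqVlt => /predU1P[->|t1]; first by rewrite epos_tgt => /(epos_vpos t01).
by apply: epos_inj => //; rewrite t0.
Qed.

Lemma jump_mid e t t' : mid t -> mid t' ->
  jump (epos e t) (epos e t') = (phase e t' * (phase e t)^-1)%g.
Proof.
move=> mt mt'; apply: xget_unique; first by exists e, t, t'.
move=> c [e1 [t1 [t1' [m1 m1' E E' ->]]]].
have [? ?] := epos_inj (mid01 m1) (mid01 mt) E; subst e1 t1.
by have [_ ->] := epos_inj (mid01 m1') (mid01 mt') E'.
Qed.

Lemma jump_outl z z' : (forall e t, mid t -> epos e t <> z) -> jump z z' = 1%g.
Proof.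
move=> out; apply: xgetPN => c [e [t [t' [mt _ /(out _ _ mt)]]]] //.
Qed.

Lemma jump_outr z z' : (forall e t, mid t -> epos e t <> z') -> jump z z' = 1%g.
Proof.
move=> out; apply: xgetPN => c [e [t [t' [_ mt _ /(out _ _ mt)]]]] //.
Qed.

Lemma jumpV z z' : jump z' z = (jump z z')^-1%g.
Proof.
have [[e [t [t' [mt mt' <- <-]]]]|no] := pselect (exists e t t',
    [/\ mid t, mid t', epos e t = z & epos e t' = z']).
  by rewrite !jump_mid// invgM invgK.
rewrite /jump !xgetPN ?invg1// => c [e [t [t' [? ? ? ? _]]]]; apply: no.
  by exists e, t, t'.
by exists e, t', t.
Qed.

Lemma phase0 e t : t < 2^-1 -> phase e t = 1%g.
Proof. by rewrite /phase => ->. Qed.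

Lemma phase1 e t : 2^-1 <= t -> phase e t = w e.
Proof. by rewrite /phase leNgt => /negbTE ->. Qed.

Lemma epos_out e t : 0 <= t <= 1 -> ~~ mid t ->
  forall e' t', mid t' -> epos e' t' <> epos e t.
Proof.
by move=> t01 /negP mt e' t' mt' /(epos_interior_inj (mid01 mt') t01)[_ tt']; rewrite -tt' in mt.
Qed.

(** Two points of an edge at parameters closer than [1/4] on different sides of the
    midpoint both lie in the interior half, so that [jump] sees the crossing. *)
Lemma jump_edge e t t' : 0 <= t <= 1 -> 0 <= t' <= 1 -> `|t - t'| < 4^-1 ->
  jump (epos e t) (epos e t') = (phase e t' * (phase e t)^-1)%g.
Proof.
move=> t01 t01' tt'; have [mt|mt] := boolP (mid t); last first.
  rewrite jump_outl; last exact: epos_out.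
  move: mt tt'; rewrite negb_and -!leNgt ltr_norml => /orP[?|?] ?.
    by rewrite !phase0 ?mulgV//; lra.
  by rewrite !phase1 ?mulgV//; lra.
have [mt'|mt'] := boolP (mid t'); first exact: jump_mid.
rewrite jump_outr; last exact: epos_out.
move: mt' tt'; rewrite negb_and -!leNgt ltr_norml => /orP[?|?] ?.
  by rewrite !phase0 ?mulgV//; lra.
by rewrite !phase1 ?mulgV//; lra.
Qed.

Lemma jump_dart d s s' : 0 <= s <= 1 -> 0 <= s' <= 1 -> `|s - s'| < 4^-1 ->
  jump (dpos d s) (dpos d s') = (dart_phase d s' * (dart_phase d s)^-1)%g.
Proof.
case: d => e [] s01 s01' ss'; first exact: jump_edge.
rewrite /dpos /dart_phase /= jump_edge; [|lra|lra|].
  by rewrite invgM invgK mulgA mulgVK.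
have -> : 1 - s - (1 - s') = s' - s by ring.
by rewrite distrC.
Qed.

Lemma dart_phase0 d s : s <= 4^-1 -> dart_phase d s = 1%g.
Proof.
case: d => e [] s4; rewrite /dart_phase/=; first by rewrite phase0//; lra.
by rewrite phase1 ?mulgV//; lra.
Qed.

Lemma dart_phase1 d s : 1 - 4^-1 <= s -> dart_phase d s = dart_weight w d.
Proof.
case: d => e [] s4; rewrite /dart_phase/dart_weight/=; first by rewrite phase1//; lra.
by rewrite phase0 ?mul1g//; lra.
Qed.

Lemma dpos_out d s : 0 <= s <= 1 -> (s <= 4^-1) || (1 - 4^-1 <= s) ->
  forall e t, mid t -> epos e t <> dpos d s.
Proof.
by case: d => e [] s01 so; apply: epos_out; rewrite /mid; lra.
Qed.

End Jump.

Section Local.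
Local Open Scope ring_scope.
Variables (R : realType) (X : Type) (O : plane_graph R X).
Variables (P : groupType) (w : edge O -> P).
Implicit Types (v : vertex O) (e : edge O) (d : dart O) (t s : R) (z : R * R).

Lemma arc_gap e a b z : 0 <= a -> b <= 1 ->
  (forall t, a <= t <= b -> epos e t <> z) ->
  exists2 r, 0 < r & forall t, a <= t <= b -> r <= `|epos e t - z|.
Proof.
move=> a0 b1 ez.
have ab : `[a, b] `<=` `[0, 1].
  by move=> t; rewrite /= !in_itv/=; lra.
have [t|r r0 rz] := compact_gap (@segment_compact R a b) ab
  (@epos_continuous _ _ _ e) (w := z).
  by rewrite /= in_itv; exact: ez.
by exists r => // t tab; apply: rz; rewrite /= in_itv.
Qed.

Lemma vertices_gap z : (forall v : vertex O, vpos v <> z) ->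
  exists2 r, 0 < r & forall v : vertex O, r <= `|vpos v - z|.
Proof.
move=> vz.
have [|v _|r r0 Hr] := finite_uniform (M := fun v r => r <= `|vpos v - z|)
  (finite_vertices O); last by exists r => // v; exact: Hr.
  by move=> v r r' _; exact: le_trans.
by exists `|vpos v - z| => //; rewrite normr_gt0 subr_eq0; apply/eqP/vz.
Qed.

Lemma edges_gap (S : edge O -> R -> Prop) z :
  (forall e, exists2 r, 0 < r & forall t, S e t -> r <= `|epos e t - z|) ->
  exists2 r, 0 < r & forall e t, S e t -> r <= `|epos e t - z|.
Proof.
move=> ez.
have [|e _|r r0 Hr] := finite_uniform
  (M := fun e r => forall t, S e t -> r <= `|epos e t - z|) (finite_edges O).
- by move=> e r r' _ rr' Mr t /Mr; exact: le_trans.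
- exact: ez.
- by exists r => // e t; exact: Hr.
Qed.

Lemma drawing_epos e t : 0 <= t <= 1 -> drawing O (epos e t).
Proof. by move=> t01; right; exists e => //; exists t => //=; rewrite in_itv. Qed.

Lemma drawing_gap z : ~ drawing O z ->
  exists2 r, 0 < r & forall y, drawing O y -> r <= `|y - z|.
Proof.
move=> nz.
have [v vz|r1 r10 H1] := vertices_gap (z := z); first by apply: nz; left; exists v.
have [e|r2 r20 H2] := edges_gap (S := fun _ t => 0 <= t <= 1) (z := z).
  apply: arc_gap => // t t01 ez; apply: nz; rewrite -ez; exact: drawing_epos.
exists (Num.min r1 r2); first by rewrite lt_min r10.
move=> y [[v _ <-]|[e _ [t]]]; rewrite ge_min; first by rewrite H1.
by rewrite /= in_itv => t01 <-; rewrite H2// orbT.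
Qed.

Lemma jump_local_vertex v :
  exists2 r, 0 < r & coboundary_on (jump w) (drawing O `&` disc (vpos v : R * R) r).
Proof.
have [e|r r0 Hr] := edges_gap
  (S := fun _ t => 4^-1 <= t <= 1 - 4^-1) (z := vpos v : R * R).
  by apply: arc_gap; [lra|lra|move=> t ?; apply: epos_vpos; lra].
exists r => //; exists (fun=> 1%g) => y y' [_ yr] _.
rewrite jump_outl ?mulgV// => e t mt ey; move: yr.
rewrite /disc /= -ey ltNge Hr//.
by move: mt; rewrite /mid; lra.
Qed.

(** Near an interior point of [e0] the graph consists of a short piece of [e0]
    only, since the rest of the drawing is compact and avoids the point; there
    [phase] of the parameter on [e0] is a potential. *)
Lemma jump_local_edge e0 t0 : 0 < t0 < 1 ->
  exists2 r, 0 < r & coboundary_on (jump w) (drawing O `&` disc (epos e0 t0) r).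
Proof.
move=> t0i; set z := epos e0 t0.
have [v vz|r1 r10 H1] := vertices_gap (z := z); first exact: (epos_vpos t0i (esym vz)).
pose far e t := 0 <= t <= 1 /\ (e = e0 -> ~~ (t0 - 8^-1 < t < t0 + 8^-1)).
have [e|r2 r20 H2] := edges_gap (S := far) (z := z).
  have [ee0|ne] := eqVneq e e0; last first.
    have [|||r r0 Hr] := arc_gap (e := e) (a := 0) (b := 1) (z := z) => //.
      move=> t t01 /esym /(epos_interior_inj t0i t01)[ee0 _].
      by rewrite ee0 eqxx in ne.
    by exists r => // t [t01 _]; exact: Hr.
  have gap a b : 0 <= a -> b <= 1 -> b < t0 \/ t0 < a ->
      exists2 r, 0 < r & forall t, a <= t <= b -> r <= `|epos e t - z|.
    move=> a0 b1 ab; apply: arc_gap => // t tab ez.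
    have t01 : 0 <= t <= 1 by lra.
    have [_ tt0] := epos_interior_inj t0i t01 (esym ez).
    by move: tab; rewrite -tt0; case: ab; lra.
  have [|||r r0 Hr] := gap 0 (t0 - 8^-1); [lra|lra|left; lra|].
  have [|||r' r'0 Hr'] := gap (t0 + 8^-1) 1; [lra|lra|right; lra|].
  exists (Num.min r r'); first by rewrite lt_min r0.
  move=> t [t01 /(_ ee0)]; rewrite negb_and -!leNgt => /orP[tt|tt]; rewrite ge_min.
    by rewrite Hr//; lra.
  by rewrite Hr' ?orbT//; lra.
have r0 : 0 < Num.min r1 r2 by rewrite lt_min r10.
exists (Num.min r1 r2) => //.
have on_arc y : (drawing O `&` disc z (Num.min r1 r2)) y ->
    exists t, [/\ 0 < t < 1, `|t - t0| < 8^-1 & epos e0 t = y].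
  case=> [[[v _ <-]|[e _ [t]]]];rewrite /disc/= lt_min ltNge ?H1//.
  rewrite in_itv/= => t01 <- /andP[y1 y2].
  have [ee0 tt0] : e = e0 /\ t0 - 8^-1 < t < t0 + 8^-1.
    apply: contrapT => nf; move: y2; rewrite ltNge => /negP; apply; apply: H2.
    by split=> // ee0; apply/negP => tt; apply: nf.
  rewrite ee0 in y1 *; exists t; split => //; last by rewrite ltr_distl.
  have t0' : t != 0.
    by apply: contraTneq y1 => ->; rewrite epos_src negbK H1.
  have t1' : t != 1.
    by apply: contraTneq y1 => ->; rewrite epos_tgt negbK H1.
  by move: t01; rewrite !le_eqVlt eq_sym (negbTE t0') (negbTE t1').
pose s y := phase w e0 (xget 0 [set t | 0 < t < 1 /\ epos e0 t = y]).
exists s => y y' /on_arc[t [ti tt <-]] /on_arc[t' [ti' tt' <-]].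
have sE u : 0 < u < 1 -> s (epos e0 u) = phase w e0 u.
  move=> ui; rewrite /s (xget_unique _ (x := u))// => u' [ui' /esym].
  by case/(epos_inj ui ui').
rewrite !sE//; apply: jump_edge; [lra|lra|].
by have := ler_distD t0 t t'; rewrite (distrC t0 t'); lra.
Qed.

Lemma jump_local z : drawing O z ->
  exists2 r, 0 < r & coboundary_on (jump w) (drawing O `&` disc z r).
Proof.
case=> [[v _ <-]|[e _ [t]]]; first exact: jump_local_vertex.
rewrite /= in_itv/= => /andP[].
rewrite le_eqVlt => /predU1P[<- _ <-|t0].
  by rewrite epos_src; exact: jump_local_vertex.
rewrite le_eqVlt => /predU1P[-> <-|t1 <-].
  by rewrite epos_tgt; exact: jump_local_vertex.
by apply: jump_local_edge; rewrite t0.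
Qed.
End Local.

(** * The transport over a cell *)

Local Arguments sqnorm : simpl never.
Local Arguments polarE : simpl never.

Section Chart.
Local Open Scope ring_scope.
Variables (R : realType) (X : Type) (O : plane_graph R X).
Variables (P : groupType) (w : edge O -> P).
Variables (d0 : dart O) (p : seq (dart O)).
Hypotheses (p0 : (0 < size p)%N) (hol1 : holonomy w p = 1%g).
Implicit Types (e : edge O) (d : dart O) (t s u : R) (z : R * R).
Local Notation n := ((size p)%:R : R).
Definition arc u : nat := Num.truncn (u * n).
Definition frac u : R := u * n - (arc u)%:R.

(** The closed path [p] is drawn at constant speed over the unit interval; at time
    [u] it is on its dart number [arc u]. *)
Definition boundary_pos u : R * R := dpos (nth d0 p (arc u)) (frac u).
Definition boundary_phase u : P :=
  (dart_phase w (nth d0 p (arc u)) (frac u) * holonomy w (take (arc u) p))%g.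

Let n_gt0 : 0 < n. Proof. by rewrite ltr0n. Qed.

Let arcP u : 0 <= u < 1 -> [/\ (arc u < size p)%N, 0 <= frac u, frac u < 1 &
  u * n = (arc u)%:R + frac u].
Proof.
move=> /andP[u0 u1]; have un : 0 <= u * n by rewrite mulr_ge0// ltW.
have /andP[l r] := truncn_itv un; rewrite /frac -/(arc u) in l r *; split.
- rewrite -(ltr_nat R); apply: le_lt_trans l _.
  by rewrite -[ltRHS]mul1r ltr_pM2r.
- by rewrite subr_ge0.
- by move: r; rewrite -natr1; lra.
- by rewrite addrC subrK.
Qed.

Let holS i : (i < size p)%N ->
  holonomy w (take i.+1 p) = (dart_weight w (nth d0 p i) * holonomy w (take i p))%g.
Proof. by move=> ip; rewrite (take_nth d0)// holonomy_rcons. Qed.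

Let boundary_jump_lt u u' : 0 <= u -> u <= u' -> u' < 1 ->
  (u' - u) * n < 4^-1 \/ (1 - 4^-1 / n < u' - u) ->
  jump w (boundary_pos u) (boundary_pos u') =
  (boundary_phase u' * (boundary_phase u)^-1)%g.
Proof.
move=> u0 uu' u1 close.
have natr2 k : k.+2%:R = k%:R + 2 :> R by rewrite -addn2 natrD.
have [|ip s0 s1 ue] := arcP (u := u); first lra.
have [|ip' s0' s1' ue'] := arcP (u := u'); first lra.
rewrite /boundary_pos /boundary_phase.
case: close => close.
  have lo : (arc u)%:R < (arc u').+1%:R :> R.
    have : u * n <= u' * n by rewrite ler_pM2r.
    by rewrite ue ue' -natr1; lra.
  have hi : (arc u')%:R < (arc u).+2%:R :> R.
    by move: close; rewrite mulrBl ue ue' (natr2 (arc u)); lra.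
  rewrite !ltr_nat in lo hi.
  have [ai|ai] : arc u' = arc u \/ arc u' = (arc u).+1.
    by move: lo hi; rewrite !ltnS; case: ltngtP => // ? _ ?; [right; apply/eqP; rewrite eqn_leq; apply/andP|left].
    rewrite ai jump_dart; [|lra|lra|].
      by rewrite invgM mulgA mulgK.
    by move: close; rewrite mulrBl ue ue' ai ltr_norml => close;
      have : u * n <= u' * n; [rewrite ler_pM2r|rewrite ue ue' ai; lra].
  have sB : 1 + frac u' - frac u < 4^-1.
    by move: close; rewrite mulrBl ue ue' ai -natr1; lra.
  rewrite jump_outl; last by apply: dpos_out; [lra|apply/orP; right; lra].
  rewrite ai holS// dart_phase0 ?dart_phase1; [|lra|lra].
  by rewrite mul1g mulgV.
have nn : 4^-1 / n * n = 4^-1 by rewrite divfK ?gt_eqF.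
have un : u * n < 4^-1.
  have : u < 4^-1 / n by lra.
  by rewrite -(ltr_pM2r n_gt0) nn.
have un' : n - 4^-1 < u' * n.
  have : 1 - 4^-1 / n < u' by lra.
  by rewrite -(ltr_pM2r n_gt0) mulrBl mul1r nn.
have ai : arc u = 0%N.
  have : (arc u)%:R < 1%:R :> R by lra.
  by rewrite ltr_nat ltnS leqn0 => /eqP.
have ai' : size p = (arc u').+1.
  have : n < (arc u').+2%:R by rewrite natr2; lra.
  by rewrite ltr_nat ltnS => le; apply/eqP; rewrite eqn_leq le.
have fu : frac u = u * n by rewrite ue ai add0r.
have fu' : 1 - 4^-1 < frac u'.
  by move: un' ; rewrite ue' ai' -natr1; lra.
rewrite jump_outl; last by apply: dpos_out; [lra|apply/orP; left; lra].
rewrite ai take0 holonomy_nil [dart_phase _ _ (frac u)]dart_phase0; last by rewrite fu; lra.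
rewrite dart_phase1; last lra.
by rewrite -holS// -ai' take_size hol1 !mulg1 mulgV.
Qed.

(** Along the boundary circle of a cell the transport [jump] is a coboundary: on
    one arc by [jump_dart], across a corner because [jump] is trivial near a vertex,
    and across the starting point because moreover the holonomy of [p] is trivial.
    The bound on the cosine says that [u] and [u'] differ by less than a quarter of
    an arc modulo [1]. *)
Lemma boundary_jump u u' : 0 <= u < 1 -> 0 <= u' < 1 ->
  cos (2 * pi * (4^-1 / n)) < cos (2 * pi * (u - u')) ->
  jump w (boundary_pos u) (boundary_pos u') =
  (boundary_phase u' * (boundary_phase u)^-1)%g.
Proof.
have cosC x y : cos (2 * pi * (x - y)) = cos (2 * pi * (y - x)) :> R.
  by rewrite -cosN; congr cos; ring.
wlog uu' : u u' / u <= u'.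
  move=> W ui ui' cc; have [uu'|/ltW uu'] := leP u u'; first exact: W.
  by rewrite jumpV W ?invgM ?invgK// cosC.
move=> /andP[u0 u1] /andP[u0' u1'] cc.
apply: (boundary_jump_lt u0 uu' u1').
have t0 : 0 < 4^-1 / n by rewrite divr_gt0.
have t1 : 4^-1 / n <= 2^-1.
  rewrite ler_pdivrMr//; have : 1 <= n by rewrite ler1n.
  lra.
have cc' : cos (2 * pi * (4^-1 / n)) < cos (2 * pi * (u' - u)).
  by rewrite cosC.
have [a|a] := ltP (u' - u) (4^-1 / n); first by left; rewrite -ltr_pdivlMr.
right; rewrite ltNge; apply/negP => b.
by have := cos_gap t0 t1 a b; rewrite leNgt cc'.
Qed.

Variables (C : set (R * R)) (phi : R * R -> R * R).
Hypotheses (C_out : C `<=` ~` drawing O)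
  (phi_cont : {within closed_disk (R := R), continuous phi})
  (phi_bij : set_bij (open_disk (R := R)) C phi)
  (phi_circle : forall (i : 'I_(size p)) s, 0 <= s <= 1 ->
    phi (circle ((i%:R + s) / n)) = dpos (tnth (in_tuple p) i) s).

Lemma phi_boundary u : 0 <= u < 1 -> phi (circle u) = boundary_pos u.
Proof.
move=> u01; have [ip s0 s1 ue] := arcP u01.
have := phi_circle (Ordinal ip) (s := frac u).
rewrite -ue mulfK ?gt_eqF// => ->; last by lra.
by rewrite /boundary_pos (tnth_nth d0).
Qed.

Lemma boundary_drawing u : 0 <= u < 1 -> drawing O (boundary_pos u).
Proof.
move=> u01; have [_ s0 s1 _] := arcP u01.
by rewrite /boundary_pos /dpos; apply: drawing_epos; case: ifP => _; lra.
Qed.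

(** The transport extends over a cell: away from the boundary ([inner]) it is
    trivial in the frame of the cell, and near the boundary a point is pushed
    radially, by less than [eta], to a point [ret z] of the graph, where [kappa]
    translates between the two frames. *)
Lemma cell_chart eta : 0 < eta ->
  exists (inner : set (R * R)) (ret : R * R -> R * R) (kappa : R * R -> P),
  [/\ inner `<=` C,
      forall z0, ~ inner z0 ->
        exists2 r, 0 < r & forall q, inner q -> r <= `|q - z0|,
      forall z, C z -> ~ inner z -> drawing O (ret z) /\ `|z - ret z| < eta &
      forall z0, inner z0 -> exists2 r, 0 < r &
        forall z z', C z -> C z' -> ~ inner z -> ~ inner z' ->
        disc z0 r z -> disc z0 r z' ->
        jump w (ret z) (ret z') = (kappa z' * (kappa z)^-1)%g].
Proof.
move=> eta0.
have [phi_C phi_inj phi_surj] := phi_bij.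
have cdisk : compact (closed_disk (R := R)) by exact: compact_disk.
have [d1 d10 Hd1] := compact_uniform_continuity cdisk phi_cont eta0.
pose dl := Num.min d1 1 / 2.
have dl0 : 0 < dl by rewrite divr_gt0// lt_min d10 ltr01.
have dl1 : dl <= 2^-1 by rewrite /dl ler_pdivrMr// mulVf// ge_min lexx orbT.
have dld : dl < d1.
  have : Num.min d1 1 <= d1 by rewrite ge_min lexx.
  by rewrite /dl; lra.
pose D' : set (R * R) := [set z | sqnorm z <= (1 - dl) ^+ 2].
have cD' : compact D' by apply: compact_disk; nra.
have D'D : D' `<=` closed_disk (R := R).
  by move=> z /= zz; rewrite /closed_disk /=; apply: (le_trans zz); nra.
pose inner := phi @` D'.
have /choice[pol polP] : forall z, exists ru : R * R, C z ->
    [/\ 0 <= ru.1, 0 <= ru.2 < 1, sqnorm (polarE ru.1 ru.2) = ru.1 ^+ 2,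
        ru.1 < 1 & phi (polarE ru.1 ru.2) = z].
  move=> z; have [Cz|nCz] := pselect (C z); last by exists 0.
  have [a /= a1 az] := phi_surj _ Cz.
  have [rho [u [r0 u01 ra aE]]] := polar_coordinates a.
  exists (rho, u) => _; rewrite /= -aE; split=> //.
  have : sqnorm a < 1 by exact: a1.
  by rewrite -ra => ?; nra.
exists inner, (fun z => phi (circle (pol z).2)), (fun z => boundary_phase (pol z).2).
have outer z : C z -> ~ inner z -> 1 - dl < (pol z).1.
  move=> Cz nin; rewrite ltNge; apply/negP => le; apply: nin.
  have [r0 _ sq _ pz] := polP _ Cz.
  exists (polarE (pol z).1 (pol z).2) => //; rewrite /D'/= sq.
  by rewrite ler_pXn2r// ?nnegrE; lra.
have circle_disk u : closed_disk (circle u : R * R).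
  by rewrite /closed_disk /= cos2Dsin2.
split.
- move=> _ [a /= aD <-]; apply: phi_C => /=; apply: le_lt_trans aD _.
  nra.
- move=> z0 nz0; have [a aD az|r r0 Hr] := compact_gap cD' D'D phi_cont (w := z0).
    by apply: nz0; exists a.
  by exists r => // _ [a aD <-]; exact: Hr.
- move=> z Cz nin; have [r0 u01 sq r1 pz] := polP _ Cz; split.
    by rewrite phi_boundary//; exact: boundary_drawing.
  rewrite -{1}pz; apply: Hd1 => //.
    by rewrite /closed_disk/= -/(sqnorm (polarE _ _)) sq; nra.
  have -> : polarE (pol z).1 (pol z).2 - circle (pol z).2 =
      polarE ((pol z).1 - 1) (pol z).2.
    by rewrite /polarE /circle/=; congr (_, _) => /=; ring.
  have := outer _ Cz nin => o; apply: le_lt_trans dld.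
  rewrite norm_pair_le /= !normrM ltr0_norm; last lra.
  have c1 : `|cos (2 * pi * (pol z).2)| <= 1 by rewrite ler_norml cos_geN1 cos_le1.
  have s1 : `|sin (2 * pi * (pol z).2)| <= 1 by rewrite ler_norml sin_geN1 sin_le1.
  by apply/andP; split; nra.
move=> _ [a0 aD <-].
have a0d : sqnorm a0 < 1 by apply: (le_lt_trans aD); nra.
have n1 : 1 <= n by rewrite ler1n.
pose t := 4^-1 / n; pose g := 1 - cos (2 * pi * t).
have t0 : 0 < t by rewrite divr_gt0.
have t1 : t <= 4^-1 by rewrite ler_pdivrMr//; lra.
have g0 : 0 < g.
  have p_gt0 := pi_gt0 R.
  rewrite subr_gt0 -[ltRHS](@cos0 R) ltr_cos ?in_itv/=; nra.
pose r' := Num.min 1 g / 16.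
have r'0 : 0 < r' by rewrite divr_gt0// lt_min ltr01.
have r'1 : r' <= 16^-1 by rewrite /r' ler_pdivrMr// mulVf// ge_min lexx.
have r'g : r' <= g / 16 by rewrite /r' ler_pM2r// ge_min lexx orbT.
(* A point that phi sends near [phi a0] lies in the disc of radius r' at [a0]: the
   rest of the closed disk is compact and its image avoids [phi a0]. *)
have cK : compact (closed_disk (R := R) `&` ~` disc a0 r').
  apply: compact_closedI => //; apply: open_closedC.
  have -> : disc a0 r' = ball a0 r' by rewrite -ball_normE; apply/seteqP; split=> y; rewrite /disc /= distrC.
  exact: ball_open.
have [|x [xd xf] xa|r r0 Hr] := compact_gap cK _ phi_cont (w := phi a0).
- by move=> x [].
- have [x1|x1] := ltP (sqnorm x) 1.
    apply: xf; rewrite (phi_inj x a0) ?inE// /disc/= subrr normr0//.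
  have [rho [u [rho0 u01 rhoE xE]]] := polar_coordinates x.
  have rho1 : rho = 1.
    have : rho ^+ 2 = 1 by rewrite rhoE; apply/eqP; rewrite eq_le x1 andbT.
    by move=> /eqP; rewrite sqrf_eq1 => /orP[/eqP//|/eqP]; lra.
  have xc : x = circle u by rewrite xE rho1 /polarE !mul1r.
  apply: (C_out (phi_C a0 _)) => //; rewrite -xa xc phi_boundary//.
  exact: boundary_drawing.
exists r => // z z' Cz Cz' nz nz' zr zr'.
have [rho0 u01 sq r1 pz] := polP _ Cz; have rho1 := outer _ Cz nz.
have [rho0' u01' sq' r1' pz'] := polP _ Cz'; have rho1' := outer _ Cz' nz'.
rewrite !phi_boundary//; apply: boundary_jump => //.
have near x : C x -> disc (phi a0) r x ->
    `|polarE (pol x).1 (pol x).2 - a0| < r'.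
  move=> Cx xr; have [? ? sqx ? px] := polP _ Cx.
  rewrite ltNge; apply/negP => far; move: xr; rewrite /disc/= -{1}px ltNge.
  rewrite Hr//; split; last by rewrite /disc/= => ?; lra.
  by rewrite /closed_disk/= -/(sqnorm (polarE _ _)) sqx; nra.
have aa : `|polarE (pol z).1 (pol z).2 - polarE (pol z').1 (pol z').2| < 2 * r'.
  have := near _ Cz zr; have := near _ Cz' zr'.
  have := ler_distD a0 (polarE (pol z).1 (pol z).2) (polarE (pol z').1 (pol z').2).
  by rewrite (distrC a0); lra.
have r'2 : 0 < 2 * r' by lra.
have small := sqnorm_norm_lt r'2 aa.
have half : 2^-1 <= (pol z).1 by lra.
have half' : 2^-1 <= (pol z').1 by lra.
have le := polar_dist (pol z).2 (pol z').2 half half'.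
have : r' ^+ 2 <= 16^-1 * r' by rewrite expr2 ler_pM2r.
by rewrite -/t; move: le small r'g; rewrite /g; nra.
Qed.

End Chart.

(** * A weight that is trivial around the cells is a coboundary *)

Section Gluing.
Local Open Scope ring_scope.
Variables (R : realType) (X : Type) (O : plane_graph R X).
Variables (P : groupType) (w : edge O -> P).
Implicit Types (e : edge O) (d : dart O) (t s u : R) (z : R * R).

Definition face z := connected_component (~` drawing O) z.

Lemma face_refl z : ~ drawing O z -> face z z.
Proof. by move=> nz; exact: connected_component_refl. Qed.

Lemma face_eq z z' : face z z' -> face z' = face z.
Proof. by move=> zz'; rewrite /face -(same_connected_component zz'). Qed.

Lemma face_out z z' : face z z' -> ~ drawing O z'.
Proof. exact: connected_component_sub. Qed.

Lemma face_disc z : ~ drawing O z -> exists2 r, 0 < r & disc z r `<=` face z.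
Proof.
move=> nz; have [r r0 Hr] := drawing_gap nz; exists r => // y yr.
pose h t : R * R := (z.1 + t * (y.1 - z.1), z.2 + t * (y.2 - z.2)).
have h0 : h 0 = z by rewrite /h !mul0r !addr0; case: (z).
have h1 : h 1 = y by rewrite /h !mul1r (addrC z.1) (addrC z.2) !subrK; case: (y).
have hc : continuous h.
  move=> t; have line a b : (fun t => a + t * b : R) @ t --> a + t * b.
    by apply: cvgD; [exact: cvg_cst|apply: cvgM; [exact: cvg_id|exact: cvg_cst]].
  exact: (cvg_pair (line _ _) (line _ _)).
apply: (@connected_component_max _ _ (h @` `[0, 1])).
- by exists 0 => //=; rewrite in_itv/= lexx ler01.
- move=> _ [t /= +] <-; rewrite in_itv/= => t01 dh.
  have := Hr _ dh; rewrite leNgt => /negP; apply.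
  move: yr; rewrite /disc/= !norm_pair_lt/= (addrC z.1) (addrC z.2) !addrK.
  rewrite !normrM => /andP[y1 y2]; rewrite ger0_norm; last lra.
  by apply/andP; split; [apply: le_lt_trans y1|apply: le_lt_trans y2];
    rewrite ler_piMl//; lra.
- apply: connected_continuous_connected; first exact: segment_connected.
  exact: continuous_subspaceT.
- by exists 1 => //=; rewrite in_itv/= lexx ler01.
Qed.

Definition region : set (R * R) := ~` outer O.

Lemma drawing_region : drawing O `<=` region.
Proof.
by move=> z dz [C [[x _ <-] _] /face_out]; exact.
Qed.

Lemma region_cell z : region z -> ~ drawing O z -> cells O (face z).
Proof.
move=> Dz nz; split; first by exists z.
by apply: contrapT => nb; apply: Dz; exists (face z); [split=> //; exists z|exact: face_refl].
Qed.

Lemma cell_region C : cells O C -> C `<=` region.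
Proof.
move=> [[x _ <-] bx] z xz [C' [[x' _ <-] nbx'] xz']; apply: nbx'.
by rewrite -/(face x') -(face_eq xz') (face_eq xz).
Qed.

Hypothesis region_compact : compact region.
Hypothesis cells_trivial : forall C, cells O C ->
  exists p, cell_boundary C p /\ holonomy w p = 1%g.

Let jump_uniform : exists2 r, 0 < r &
  forall z, region z -> coboundary_on (jump w) (drawing O `&` disc z r).
Proof.
apply: (lebesgue_number (Q := fun B => coboundary_on (jump w) (drawing O `&` B))) => //.
  by move=> A B BA; apply: coboundary_sub => z [? /BA].
move=> z _; have [dz|nz] := pselect (drawing O z); first exact: jump_local.
have [r r0 Hr] := drawing_gap nz; exists r => //; exists (fun=> 1%g).
by move=> y y' [/Hr + yr]; rewrite leNgt yr.
Qed.

Definition far eta z := forall y, drawing O y -> eta <= `|y - z|.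

Lemma far_out eta z : 0 < eta -> far eta z -> ~ drawing O z.
Proof. by move=> e0 fz /fz; rewrite subrr normr0 leNgt e0. Qed.

Let cell_charts eta : 0 < eta ->
  exists (inner : set (R * R) -> set (R * R))
    (ret : set (R * R) -> R * R -> R * R) (kappa : set (R * R) -> R * R -> P),
  forall C, cells O C ->
  [/\ inner C `<=` C,
      forall z0, ~ inner C z0 ->
        exists2 r, 0 < r & forall q, inner C q -> r <= `|q - z0|,
      forall z, C z -> ~ inner C z -> drawing O (ret C z) /\ `|z - ret C z| < eta &
      forall z0, inner C z0 -> exists2 r, 0 < r &
        forall z z', C z -> C z' -> ~ inner C z -> ~ inner C z' ->
        disc z0 r z -> disc z0 r z' ->
        jump w (ret C z) (ret C z') = (kappa C z' * (kappa C z)^-1)%g].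
Proof.
move=> eta0.
have /choice[F HF] : forall C, exists F : set (R * R) * (R * R -> R * R) * (R * R -> P),
  cells O C ->
  [/\ F.1.1 `<=` C,
      forall z0, ~ F.1.1 z0 ->
        exists2 r, 0 < r & forall q, F.1.1 q -> r <= `|q - z0|,
      forall z, C z -> ~ F.1.1 z -> drawing O (F.1.2 z) /\ `|z - F.1.2 z| < eta &
      forall z0, F.1.1 z0 -> exists2 r, 0 < r &
        forall z z', C z -> C z' -> ~ F.1.1 z -> ~ F.1.1 z' ->
        disc z0 r z -> disc z0 r z' ->
        jump w (F.1.2 z) (F.1.2 z') = (F.2 z' * (F.2 z)^-1)%g].
  move=> C; have [cC|ncC] := pselect (cells O C); last by exists (set0, id, fun=> 1%g).
  have [[|d0 p] [[[v [p0 _]] [phi [pc pb pp]]] hp]] := cells_trivial cC => //.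
  have Cout : C `<=` ~` drawing O.
    by case: cC => [[x _ <-] _]; exact: connected_component_sub.
  have [I [r [k H]]] := cell_chart d0 (p := d0 :: p) isT hp Cout pc pb pp eta0.
  by exists (I, r, k).
by exists (fun C => (F C).1.1), (fun C => (F C).1.2), (fun C => (F C).2).
Qed.

(** The charts of the cells and the transport on the graph combine to a transport
    on the whole region.  Only the thick cells, those with a point at distance at
    least [eta] from the graph, are given an inner part; a thin cell is entirely
    pushed to the graph.  The inner parts have a positive distance to each point
    of the graph together, not only one by one, because [far] points form a compact
    set on which the inner part depends locally constantly on the point. *)
Lemma transport : exists T : R * R -> R * R -> P,
  (forall z z', drawing O z -> drawing O z' -> T z z' = jump w z z') /\
  forall z0, region z0 -> exists2 r, 0 < r & coboundary_on T (region `&` disc z0 r).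
Proof.
have [eps eps0 Heps] := jump_uniform.
pose eta := eps / 3; have eta0 : 0 < eta by rewrite divr_gt0.
have [inner [ret [kappa charts]]] := cell_charts eta0.
pose thick C := exists2 z, C z & far eta z.
pose inn z := [/\ ~ drawing O z, thick (face z) & inner (face z) z].
have /choice[pi0 piP] : forall z, exists y, region z -> ~ inn z ->
    [/\ drawing O y, `|z - y| < eta, drawing O z -> y = z &
        ~ drawing O z -> thick (face z) -> y = ret (face z) z].
  move=> z; have [dz|nz] := pselect (drawing O z).
    by exists z => _ _; split=> //; rewrite subrr normr0.
  have [tk|ntk] := pselect (thick (face z)).
    exists (ret (face z) z) => Dz ninn.
    have [_ _ H _] := charts _ (region_cell Dz nz).
    have [||? ?] := H z; [exact: face_refl|by move=> iz; apply: ninn|].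
    by split.
  have : ~ far eta z by move=> fz; apply: ntk; exists z => //; exact: face_refl.
  move=> /existsNP[y /not_implyP[dy /negP]]; rewrite -ltNge distrC => yz.
  by exists y.
(* The frame at an inner point is the one of its cell, elsewhere the one of the
   nearby point [pi0 z] of the graph. *)
pose T z z' : P := if `[< inn z \/ inn z' >]
  then (kappa (face z') z' * (kappa (face z) z)^-1)%g else jump w (pi0 z) (pi0 z').
have inn_draw z : drawing O z -> ~ inn z by move=> dz [].
exists T; split=> [z z' dz dz'|z0 Dz0].
  rewrite /T asboolF; last by case; apply: inn_draw.
  have [_ _ -> // _] := piP _ (drawing_region dz) (inn_draw _ dz).
  by have [_ _ -> // _] := piP _ (drawing_region dz') (inn_draw _ dz').
have [iz0|niz0] := pselect (inn z0).
  have [nz0 tk iz0'] := iz0.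
  have [r1 r10 H1] := face_disc nz0.
  have [_ _ _ /(_ _ iz0')[r2 r20 H2]] := charts _ (region_cell Dz0 nz0).
  exists (Num.min r1 r2); first by rewrite lt_min r10.
  exists (fun z => kappa (face z) z) => y y'; rewrite /disc/= !lt_min.
  move=> [Dy /andP[/H1 fy y2]] [Dy' /andP[/H1 fy' y2']].
  rewrite /T; case: asboolP => // /not_orP[ny ny'].
  have [dy dy'] := (face_out fy, face_out fy').
  have [_ _ _ ->//] := piP _ Dy ny; last by rewrite (face_eq fy).
  have [_ _ _ ->//] := piP _ Dy' ny'; last by rewrite (face_eq fy').
  rewrite (face_eq fy) (face_eq fy'); apply: H2 => //.
    by move=> iy; apply: ny; split; rewrite ?(face_eq fy).
  by move=> iy; apply: ny'; split; rewrite ?(face_eq fy').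
(* The inner parts of the cells form a relatively closed subset of the region. *)
have [r r0 Hr] : exists2 r, 0 < r & forall y, region y -> disc z0 r y -> ~ inn y.
  have [dz0|nz0] := pselect (drawing O z0); last first.
    have [r1 r10 H1] := face_disc nz0.
    have [tk|ntk] := pselect (thick (face z0)); last first.
      by exists r1 => // y _ /H1 fy [_ + _]; rewrite (face_eq fy).
    have [_ gap _ _] := charts _ (region_cell Dz0 nz0).
    have [|r2 r20 H2] := gap z0; first by move=> iz; apply: niz0.
    exists (Num.min r1 r2); first by rewrite lt_min r10.
    move=> y _; rewrite /disc/= lt_min => /andP[/H1 fy yr] [_ _].
    by rewrite (face_eq fy) => /H2; rewrite leNgt yr.
  have [||r r0 Hr] := compact_uniform (M := fun z r => far eta z ->
      forall q, inner (face z) q -> r <= `|q - z0|) region_compact.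
  - by move=> x r r' _ rr' H fx q /(H fx); exact: le_trans.
  - move=> x Dx; have [fx|/existsNP[y /not_implyP[dy /negP]]] := pselect (far eta x).
      have nx := far_out eta0 fx; have [r1 r10 H1] := face_disc nx.
      have [sub gap _ _] := charts _ (region_cell Dx nx).
      have [|r2 r20 H2] := gap z0; first by move=> /sub /face_out.
      exists (Num.min r1 r2); first by rewrite lt_min r10.
      move=> y _; rewrite lt_min => /andP[/H1 fy _] _ q.
      by rewrite (face_eq fy) ge_min => /H2 ->; rewrite orbT.
    rewrite -ltNge => yx; exists (eta - `|y - x|); first by rewrite subr_gt0.
    move=> z _ zx /(_ _ dy); have := ler_distD x y z; rewrite (distrC x z); lra.
  exists r => // y Dy yr [ny [x fx farx] iy].
  have Dx := cell_region (region_cell Dy ny) fx.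
  by have := Hr _ Dx farx y; rewrite (face_eq fx) leNgt yr => /(_ iy).
have m0 : 0 < Num.min r eta by rewrite lt_min r0.
exists (Num.min r eta) => //.
have [dp0 p0 _ _] := piP _ Dz0 niz0.
have [s Hs] := Heps _ (drawing_region dp0).
exists (s \o pi0) => y y'; rewrite /disc/= !lt_min.
move=> [Dy /andP[/(Hr _ Dy) ny y2]] [Dy' /andP[/(Hr _ Dy') ny' y2']].
rewrite /T asboolF; last by case.
have close x : region x -> ~ inn x -> `|x - z0| < eta ->
    (drawing O `&` disc (pi0 z0) eps) (pi0 x).
  move=> Dx nx xz; have [dx px _ _] := piP _ Dx nx; split => //; rewrite /disc/=.
  have := ler_distD x (pi0 x) (pi0 z0); have := ler_distD z0 x (pi0 z0).
  by rewrite (distrC (pi0 x) x); move: px p0 xz; rewrite /eta; lra.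
by apply: Hs; exact: close.
Qed.

End Gluing.

Section Disk.
Local Open Scope ring_scope.
Variables (R : realType) (P : groupType).
Implicit Types (x : R * R).

(** A flat transport over a disk is globally trivial at small scale: [S N x] is the
    transport along the ray from the center to [x], in [N] steps, and the rays to
    two nearby points are compared by [N] small quadrilaterals. *)
Lemma disk_potential (D : set (R * R)) (T : R * R -> R * R -> P) (f : R * R -> R * R) :
  compact D -> f @` closed_disk (R := R) `<=` D ->
  {within closed_disk (R := R), continuous f} ->
  (forall z, D z -> exists2 r, 0 < r & coboundary_on T (D `&` disc z r)) ->
  exists S : R * R -> P, exists2 r, 0 < r & forall x x',
    closed_disk x -> closed_disk x' -> `|x' - x| < r ->
    T (f x) (f x') = (S x' * (S x)^-1)%g.
Proof.
move=> cD fD fc loc.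
have [|eps eps0 Heps] := lebesgue_number (Q := fun B => coboundary_on T (D `&` B)) cD _ loc.
  by move=> A B BA; apply: coboundary_sub => z [? /BA].
have cdisk : compact (closed_disk (R := R)) by exact: compact_disk.
have [r r0 Hr] := compact_uniform_continuity cdisk fc eps0.
have [N N0 Nr] : exists2 N : nat, (0 < N)%N & N%:R^-1 < r / 2.
  by apply: small_step; rewrite divr_gt0.
have Np : 0 < N%:R :> R by rewrite ltr0n.
pose ray k x : R * R := (k%:R / N%:R * x.1, k%:R / N%:R * x.2).
have k01 k : (k <= N)%N -> 0 <= (k%:R / N%:R : R) <= 1.
  by move=> kN; rewrite divr_ge0//= ler_pdivrMr// mul1r ler_nat.
have ray_disk k x : (k <= N)%N -> closed_disk x -> closed_disk (ray k x).
  move=> /k01; rewrite /closed_disk /ray /=; move: (_ / _) => c /andP[c0 c1] x1.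
  rewrite !exprMn -mulrDr; apply: mulr_ile1 => //; rewrite ?addr_ge0 ?sqr_ge0//.
  exact: exprn_ile1.
have ray_step k x : closed_disk x -> `|ray k.+1 x - ray k x| < r / 2.
  move=> /sqnorm_norm_le; rewrite norm_pair_le => /andP[x1 x2].
  rewrite norm_pair_lt /ray/= -!mulrBl -natrB// subSnn mul1r !normrM.
  have i0 : 0 < (N%:R : R)^-1 by rewrite invr_gt0.
  by rewrite gtr0_norm//; apply/andP; split; nra.
have ray_near k x x' : (k <= N)%N -> `|x' - x| < r / 2 ->
    `|ray k x' - ray k x| < r / 2.
  move=> /k01; rewrite !norm_pair_lt /ray/=; move: (_ / _) => c c01 /andP[x1 x2].
  rewrite -!mulrBr !normrM ger0_norm; last by case/andP: c01.
  have := normr_ge0 (x'.1 - x.1); have := normr_ge0 (x'.2 - x.2).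
  by move=> ? ?; apply/andP; split; nra.
pose S := fix S k x : P :=
  if k is k'.+1 then (T (f (ray k' x)) (f (ray k'.+1 x)) * S k' x)%g else 1%g.
exists (S N), (r / 2); first by rewrite divr_gt0.
move=> x x' dx dx' xx'.
have ray0 y : ray 0%N y = (0, 0) by rewrite /ray !mul0r.
have rayN y : ray N y = y by rewrite /ray divff ?gt_eqF// !mul1r; case: (y).
suff H k : (k <= N)%N -> S k x' = (T (f (ray k x)) (f (ray k x')) * S k x)%g.
  by rewrite -{1}(rayN x) -{1}(rayN x') H// mulgK.
elim: k => [_|k IH kN].
  rewrite /= !ray0 mulg1.
  have [|s Hs] := Heps (f (0, 0)).
    by apply: fD; exists (0, 0) => //; rewrite -(ray0 x); exact: ray_disk.
  have b0 : (D `&` disc (f (0, 0)) eps) (f (0, 0)).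
    split; last by rewrite /disc/= subrr normr0.
    by apply: fD; exists (0, 0) => //; rewrite -(ray0 x); exact: ray_disk.
  by rewrite Hs// mulgV.
rewrite /= IH ?(ltnW kN)//.
have kN' := ltnW kN.
have inD y j : (j <= N)%N -> closed_disk y -> D (f (ray j y)).
  by move=> jN dy; apply: fD; exists (ray j y) => //; exact: ray_disk.
have [|s Hs] := Heps (f (ray k x)); first exact: inD.
have ball y : closed_disk y -> D (f y) -> `|y - ray k x| < r ->
    (D `&` disc (f (ray k x)) eps) (f y).
  by move=> dy Dy yx; split=> //; apply: Hr => //; exact: ray_disk.
have b1 : (D `&` disc (f (ray k x)) eps) (f (ray k x)).
  by apply: ball; [exact: ray_disk|exact: inD|rewrite subrr normr0].
have b2 : (D `&` disc (f (ray k x)) eps) (f (ray k x')).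
  apply: ball; [exact: ray_disk|exact: inD|].
  by have := ray_near k _ _ kN' xx'; lra.
have b3 : (D `&` disc (f (ray k x)) eps) (f (ray k.+1 x)).
  apply: ball; [exact: ray_disk|exact: inD|].
  by have := ray_step k _ dx; lra.
have b4 : (D `&` disc (f (ray k x)) eps) (f (ray k.+1 x')).
  apply: ball; [exact: ray_disk|exact: inD|].
  have := ler_distD (ray k x') (ray k.+1 x') (ray k x).
  by have := ray_near k _ _ kN' xx'; have := ray_step k _ dx'; lra.
by rewrite (Hs _ _ b2 b4) (Hs _ _ b1 b2) (Hs _ _ b3 b4) (Hs _ _ b1 b3) !mulgA !mulgVK.
Qed.

End Disk.

Section Potential.
Local Open Scope ring_scope.
Variables (R : realType) (X : Type) (O : plane_graph R X).
Variables (P : groupType) (w : edge O -> P).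

(** The transport on the region is, at small scale, the coboundary of some [theta].
    Along an edge both [theta] and [phase] are potentials of it, so
    [theta^-1 * phase] is locally constant, hence equal at the two ends. *)
Theorem disk_diagram_potential :
  disk_diagram O ->
  (forall C, cells O C -> exists p, cell_boundary C p /\ holonomy w p = 1%g) ->
  exists sigma : vertex O -> P,
    forall e, w e = (sigma (tgt e) * (sigma (src e))^-1)%g.
Proof.
move=> [f [g [fc gc fD gD [_ fg]]]] cells1.
have cD : compact (region O).
  have -> : region O = f @` closed_disk (R := R).
    by apply/seteqP; split=> // y Dy; exists (g y); [apply: gD; exists y|exact: fg].
  by apply: continuous_compact => //; exact: compact_disk.
have [T [Tjump Tloc]] := transport cD cells1.
have [S [r r0 HS]] := disk_potential cD fD fc Tloc.
exists (S \o g \o @vpos _ _ O) => e.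
have De t : 0 <= t <= 1 -> region O (epos e t).
  by move=> t01; apply/drawing_region/drawing_epos.
have F01 := @locally_constant_interval R P (fun t => ((S (g (epos e t)))^-1 * phase w e t)%g) _.
have : ((S (g (epos e 0)))^-1 * phase w e 0 = (S (g (epos e 1)))^-1 * phase w e 1)%g.
  apply: F01 => t t01.
  have [d d0 Hd] := within_near gc (De _ t01) r0.
  have t01' : `[0, 1]%classic t by rewrite /= in_itv.
  have [d' d'0 Hd'] := within_near (@epos_continuous _ _ O e) t01' d0.
  have m0 : 0 < Num.min d' 4^-1 by rewrite lt_min d'0 invr_gt0 ltr0n.
  exists (Num.min d' 4^-1) => // t' ti'; rewrite lt_min => /andP[td t4].
  have et : `|epos e t' - epos e t| < d by apply: Hd' => //; rewrite /= in_itv.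
  have gt := Hd _ (De _ ti') et.
  have := Tjump _ _ (drawing_epos e t01) (drawing_epos e ti').
  rewrite jump_edge//; last by rewrite distrC.
  have gdisk s : 0 <= s <= 1 -> closed_disk (g (epos e s)).
    by move=> s01; apply: gD; exists (epos e s) => //; exact: De.
  rewrite -{1}(fg _ (De _ t01)) -{1}(fg _ (De _ ti')) HS; [|exact: gdisk|exact: gdisk|by []].
  move=> E; apply: (mulgI (S (g (epos e t')))); rewrite mulgA mulgV mul1g.
  by rewrite mulgA E mulgVK.
rewrite phase0 ?phase1 ?mulg1; [|lra|lra].
by rewrite epos_src epos_tgt /= => ->; rewrite mulgA mulgV mul1g.
Qed.

End Potential.

(** * Schreier generators of the subgroup *)

Section BoundedWords.
Variable Y : finType.

Definition words_upto N : seq (word Y) :=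
  flatten [seq [seq val t | t <- enum {: k.-tuple (Y * bool)}] | k <- iota 0 N.+1].

Lemma mem_words_upto N (u : word Y) : (size u <= N)%N -> u \in words_upto N.
Proof.
move=> uN; apply/flattenP; exists [seq val t | t <- enum {: (size u).-tuple (Y * bool)}].
  by apply/mapP; exists (size u) => //; rewrite mem_iota add0n ltnS uN.
by apply/mapP; exists (in_tuple u) => //; rewrite mem_enum.
Qed.

End BoundedWords.

Section Cosets.
Local Open Scope group_scope.
Variables (G : groupType) (H : set G).
Hypothesis subH : group_closed (mem H).

Lemma subgroup1 : H 1.
Proof. by case: subH => h _; exact: set_mem h. Qed.

Lemma subgroupV h : H h -> H h^-1.
Proof. by move=> Hh; apply: set_mem; apply: (group_closedV subH); exact: mem_set. Qed.

Lemma subgroupM h k : H h -> H k -> H (h * k).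
Proof. by move=> Hh Hk; apply: set_mem; apply: (group_closedM subH); exact: mem_set. Qed.

Lemma rho_id g : rho H g g.
Proof. by exists 1; [exact: subgroup1|rewrite mulg1]. Qed.

Lemma rhoM g h : H h -> rho H (g * h) = rho H g.
Proof.
move=> Hh; apply/seteqP; split=> _ [k Hk <-].
  by exists (h * k); [exact: subgroupM|rewrite mulgA].
by exists (h^-1 * k); [apply: subgroupM => //; exact: subgroupV|rewrite -mulgA mulVKg].
Qed.

Lemma rho_eq g g' : rho H g' = rho H g -> H (g^-1 * g').
Proof. by move=> E; have := rho_id g'; rewrite E => -[h Hh <-]; rewrite mulKg. Qed.

Lemma coset_representative : exists rep : set G -> G,
  forall g, rho H (rep (rho H g)) = rho H g.
Proof.
have /choice[rep repP] : forall K, exists t : G, cosets H K -> rho H t = K.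
  by move=> K; have [[t _ tK]|nK] := pselect (cosets H K); [exists t|exists 1].
by exists rep => g; apply: repP; exists g.
Qed.

End Cosets.

Section Schreier.
Local Open Scope group_scope.
Variables (R : realType) (G : groupType) (X : finType) (f : X -> G).
Variables (rels : seq (word X)) (H : set G).
Hypothesis subH : group_closed (mem H).
Variables (A B : set (set G)).
Hypothesis connA : connected_vertices (L := Cay f) (rho H @^-1` A).
Hypothesis diagrams : forall (g : G) (c : seq (dart (Cay f))),
  simple_closed_path (L := Cay f) g c ->
  path_in (L := Cay f) (rho H @^-1` A) c ->
  exists (O : plane_graph R X) (l : vertex O -> G),
    [/\ disk_diagram O, van_kampen rels O, vertex_labeling f l,
        boundary_eq l c & forall v, (rho H @^-1` B) (l v)].

Variables (s : seq (set G)) (rep : set G -> G).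
Hypothesis sAB : A `|` B = [set` s].
Hypothesis repP : forall g, rho H (rep (rho H g)) = rho H g.

(** The component in [H] of [g] with respect to the chosen transversal. *)
Definition hpart (g : G) : G := (rep (rho H g))^-1 * g.

Lemma hpart_in g : H (hpart g). Proof. exact: (rho_eq subH). Qed.

Lemma hpartM g h : H h -> hpart (g * h) = hpart g * h.
Proof. by move=> Hh; rewrite /hpart (rhoM subH)// mulgA. Qed.

(** The index [size s] stands for all cosets outside [s]. *)
Definition coset_idx (g : G) : 'I_(size s).+1 := inord (index (rho H g) s).

(** The Schreier generator of the edge labelled [x] that starts at the coset number
    [y.1].  The edge is the one that starts at the representative, where [hpart] is
    [1], which is why only the [hpart] of its target occurs. *)
Definition schreier_gen (y : ('I_(size s).+1 * X)%type) : G :=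
  hpart (f y.2 * rep (nth (rho H 1) s y.1)).

Lemma schreier_genE g x : rho H g \in s ->
  schreier_gen (coset_idx g, x) = hpart (f x * g) * (hpart g)^-1.
Proof.
move=> gs; rewrite /schreier_gen /coset_idx /= inordK ?ltnS ?index_size// nth_index//.
apply: (mulIg (hpart g)); rewrite mulgVK -hpartM; last exact: hpart_in.
by rewrite /hpart -mulgA mulVKg.
Qed.

Lemma coset_idxM g h : H h -> coset_idx (g * h) = coset_idx g.
Proof. by move=> Hh; rewrite /coset_idx (rhoM subH). Qed.

Variable srels : seq (word ('I_(size s).+1 * X)%type).
Let Y := ('I_(size s).+1 * X)%type.

Definition cay_label (e : edge (Cay f)) : Y := (coset_idx e.1, e.2).

Lemma A_in_s g : A (rho H g) -> rho H g \in s.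
Proof. by move=> Ag; have : (A `|` B) (rho H g); [left|rewrite sAB]. Qed.
Lemma B_in_s g : B (rho H g) -> rho H g \in s.
Proof. by move=> Ag; have : (A `|` B) (rho H g); [right|rewrite sAB]. Qed.

Lemma cay_holonomy u v p : is_path (L := Cay f) u p v ->
  path_in (L := Cay f) (rho H @^-1` A) p ->
  holonomy (schreier_gen \o cay_label) p = hpart v * (hpart u)^-1.
Proof.
move=> uv pA; apply: (holonomy_telescope (L := Cay f) (sigma := hpart)) uv => -[[g x] b] /pA dA.
apply: (dart_weight_potential (L := Cay f) (sigma := hpart)) => /=.
by rewrite schreier_genE//; apply: A_in_s; move: dA; case: b => -[].
Qed.

Hypothesis srels1 : forall r, r \in srels -> weval schreier_gen r = 1.
Hypothesis srels_short : forall r (u : word Y), r \in rels -> (size u <= size r)%N ->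
  weval schreier_gen u = 1 -> u \in srels.

(** The labels around a cell form a word that is trivial in [H], as they telescope
    along a closed path, and no longer than a relator of [G]; so it is one of the
    relators of [P]. *)
Lemma diagram_holonomy (O : plane_graph R X) (l : vertex O -> G) :
  disk_diagram O -> van_kampen rels O -> vertex_labeling f l ->
  (forall v, (rho H @^-1` B) (l v)) ->
  forall u p, is_path u p u ->
  holonomy (@pgen _ srels \o (fun e => (coset_idx (l (src e)), lab e))) p = 1.
Proof.
move=> dO vkO lO lB; set lb := fun e : edge O => _.
have [|sigma sigmaP] := disk_diagram_potential (w := @pgen _ srels \o lb) dO.
  move=> C /vkO[p [bp [r [k [rr pl]]]]]; exists p; split=> //.
  have [[v [_ vp]] _] := bp.
  rewrite holonomy_relabel weval_pgen; apply/pclassP.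
  have := pres_relator [::] [::] (srels_short (r := r) (u := relabel lb p) rr _ _).
  rewrite cats0; apply.
    rewrite size_rev size_map -(size_map (fun d => (lab d.1, d.2))) -size_rev -/(path_label p).
    by case: pl => ->; rewrite size_rot// size_rev size_map.
  rewrite -holonomy_relabel (holonomy_telescope (sigma := hpart \o l) _ vp) ?mulgV//.
  move=> d _; apply: (dart_weight_potential (sigma := hpart \o l)) => /=.
  by rewrite schreier_genE -?lO//; apply: B_in_s; exact: lB.
move=> u p up; rewrite (holonomy_telescope (sigma := sigma) _ up) ?mulgV//.
by move=> d _; apply: dart_weight_potential; exact: sigmaP.
Qed.

Lemma holonomy_transfer (O : plane_graph R X) (l : vertex O -> G) :
  vertex_labeling f l ->
  forall u v g h p q, is_path u p v -> is_path (L := Cay f) g q h -> l u = g ->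
  path_label p = path_label q ->
  holonomy (@pgen _ srels \o (fun e => (coset_idx (l (src e)), lab e))) p =
  holonomy (@pgen _ srels \o cay_label) q.
Proof.
move=> lO u v g h p q + + + /(can_inj revK).
elim: p u g q => [|[e b] p IH] u g [|[[g' x] b'] q] //=.
  by rewrite !holonomy_nil.
move=> [eu pv] [gq qv] lu [xe be pq]; subst x b'.
have [lg' lg] : l (src e) = g' /\ l (dtgt ((e, b) : dart O)) = dtgt (((g', lab e), b) : dart (Cay f)).
  move: eu gq lu; rewrite /dsrc /dtgt /=; case: (b) => /= <- <-; rewrite lO.
    by move=> ->.
  by move=> /mulgI ->.
rewrite !holonomy_cons (IH _ _ _ pv qv lg pq); congr (_ * _).
by rewrite /dart_weight /= /cay_label /= lg'.
Qed.

Lemma closed_trivial u p : is_path (L := Cay f) u p u ->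
  path_in (L := Cay f) (rho H @^-1` A) p -> holonomy (@pgen _ srels \o cay_label) p = 1.
Proof.
apply: (closed_holonomy_trivial (L := Cay f)) => {u p} g c gc cA.
have [Om [l [dO vkO lO [v [p [k [g' [[[[_ vp] _ _] _] [_ gp] lv pl]]]]] lB]]] := diagrams gc cA.
have : holonomy (@pgen _ srels \o cay_label) (rot k c) = 1.
  by rewrite -(holonomy_transfer lO vp gp lv pl); exact: diagram_holonomy vp.
rewrite /rot holonomy_cat => E; rewrite -(cat_take_drop k c) holonomy_cat.
by apply: (mulgI (holonomy (@pgen _ srels \o cay_label) (take k c))); rewrite mulgA E mul1g mulg1.
Qed.

Definition translate (h : G) (p : seq (dart (Cay f))) : seq (dart (Cay f)) :=
  [seq ((d.1.1 * h, d.1.2), d.2) | d <- p].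

Lemma translate_path u v p h : is_path (L := Cay f) u p v ->
  is_path (L := Cay f) (u * h) (translate h p) (v * h).
Proof.
elim: p u => [|[[g x] b] p IH] u /=; first by move=> ->.
by case: b => [] [<- /IH]; rewrite /dsrc/dtgt/= ?mulgA.
Qed.

Lemma translate_in p h : H h -> path_in (L := Cay f) (rho H @^-1` A) p ->
  path_in (L := Cay f) (rho H @^-1` A) (translate h p).
Proof.
move=> Hh pA _ /mapP[[[g x] b] /pA + ->].
by case: b => -[? ?]; split; rewrite /dsrc /dtgt/= ?mulgA (rhoM subH).
Qed.

Lemma translate_holonomy (Q : groupType) (w : Y -> Q) p h : H h ->
  holonomy (w \o cay_label) (translate h p) = holonomy (w \o cay_label) p.
Proof.
move=> Hh; elim: p => [//|[[g x] b] p IH]; rewrite /= !holonomy_cons IH; congr (_ * _).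
by rewrite /dart_weight /cay_label /= coset_idxM.
Qed.

Definition base : G := rep (rho H (xget 1 (rho H @^-1` A))).

Lemma base_A : A (rho H base).
Proof.
rewrite /base repP; have [[g Ag] _] := connA.
by have := xgetPex 1 (ex_intro _ g Ag).
Qed.

Lemma hpart_base : hpart base = 1.
Proof. by rewrite /hpart /base repP mulVg. Qed.

Definition A_path h p := is_path (L := Cay f) base p (base * h) /\
  path_in (L := Cay f) (rho H @^-1` A) p.

Lemma A_path_exists h : H h -> exists p, A_path h p.
Proof.
move=> Hh; apply: connA.2; first exact: base_A.
by rewrite /= (rhoM subH)//; exact: base_A.
Qed.

Lemma A_path_value h p : H h -> A_path h p -> weval schreier_gen (relabel cay_label p) = h.
Proof.
move=> Hh [bp pA]; rewrite -holonomy_relabel (cay_holonomy bp pA).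
by rewrite hpartM// hpart_base invg1 mul1g mulg1.
Qed.

Lemma schreier_gen_in y : H (schreier_gen y). Proof. exact: hpart_in. Qed.

Lemma weval_schreier_gen_in u : H (weval schreier_gen u).
Proof.
elim: u => [|[y b] u IH]; first by rewrite weval_nil; exact: (subgroup1 subH).
rewrite weval_cons; apply: (subgroupM subH) => //; case: b; first exact: schreier_gen_in.
by apply: (subgroupV subH); exact: schreier_gen_in.
Qed.

Lemma A_path_cat h k p q : H k -> A_path h p -> A_path k q ->
  A_path (h * k) (q ++ translate k p).
Proof.
move=> Hk [bp pA] [bq qA]; split.
  apply/(is_path_cat (L := Cay f)); exists (base * k) => //.
  by rewrite mulgA; exact: translate_path.
move=> d; rewrite mem_cat => /orP[/qA//|]; exact: translate_in.
Qed.

Lemma A_path_rev h p : H h -> A_path h p ->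
  A_path h^-1 (translate h^-1 (path_rev (L := Cay f) p)).
Proof.
move=> Hh [bp pA]; split.
  rewrite -{1}(mulgK h base); apply: translate_path; exact: is_path_rev.
by apply: translate_in; [exact: (subgroupV subH)|exact: path_in_rev].
Qed.

Variable gpath : Y -> seq (dart (Cay f)).
Hypothesis gpathP : forall y, A_path (schreier_gen y) (gpath y).
Hypothesis srels_gpath : forall y,
  weval schreier_gen ((y, false) :: relabel cay_label (gpath y)) = 1 ->
  (y, false) :: relabel cay_label (gpath y) \in srels.

Lemma pgen_gpath y : holonomy (@pgen _ srels \o cay_label) (gpath y) = pgen srels y.
Proof.
rewrite holonomy_relabel weval_pgen.
have := pres_relator [::] [::] (srels_gpath (y := y) _).
rewrite weval_cons (A_path_value (schreier_gen_in y) (gpathP y)) mulVg cats0 => /(_ erefl).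
move=> /pclassP; rewrite -!weval_pgen weval_cons weval_nil => E.
by apply: (mulgI (pgen srels y)^-1); rewrite mulVg.
Qed.

(** Concatenate, letter by letter, the paths over [A] that express the generators,
    translating each by the element of [H] already reached; translation by [H]
    does not change labels. *)
Lemma word_path u : exists2 p, A_path (weval schreier_gen u) p &
  holonomy (@pgen _ srels \o cay_label) p = weval (@pgen _ srels) u.
Proof.
elim: u => [|[y b] u [p pu hp]].
  exists [::]; last by rewrite holonomy_nil weval_nil.
  by split; rewrite //= weval_nil mulg1.
rewrite !weval_cons; have Hu := weval_schreier_gen_in u.
have Hy := schreier_gen_in y; have yp := gpathP y.
case: b; last first.
  exists (p ++ translate (weval schreier_gen u)
      (translate (schreier_gen y)^-1 (path_rev (L := Cay f) (gpath y)))).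
    by apply: A_path_cat => //; exact: A_path_rev.
  rewrite holonomy_cat !translate_holonomy//; last exact: (subgroupV subH).
  by rewrite holonomy_rev pgen_gpath hp.
exists (p ++ translate (weval schreier_gen u) (gpath y)); first exact: A_path_cat.
by rewrite holonomy_cat translate_holonomy// pgen_gpath hp.
Qed.

Lemma schreier_presentation : presented_by H schreier_gen srels.
Proof.
split.
  apply/seteqP; split=> [_ [u _ <-]|h Hh]; first exact: weval_schreier_gen_in.
  have [p hp] := A_path_exists Hh.
  by exists (relabel cay_label p) => //; exact: A_path_value hp.
move=> u; split=> [u1|/(pres_eq_weval srels1)]; last by rewrite weval_nil.
have [p [bp pA] hp] := word_path u; rewrite u1 mulg1 in bp.
apply/pclassP; rewrite -!weval_pgen -hp weval_nil; exact: closed_trivial bp pA.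
Qed.

End Schreier.

(** * The subgroup is finitely presented *)

Theorem proposition1p2 (R : realType) (G : groupType) (X : finType)
    (f : X -> G) (rels : seq (word X))
    (relsP : forall r : word X, r \in rels -> cyclically_reduced r)
    (presG : presented_by [set: G] f rels)
    (H : set G) (subH : group_closed (mem H)) (fgH : finitely_generated H)
    (A : set (set G)) (subA : A `<=` cosets H) (finA : finite_set A)
    (connA : connected_vertices (L := Cay f) (rho H @^-1` A))
    (diagrams : exists B : set (set G),
      [/\ B `<=` cosets H, finite_set B &
        forall (g : G) (c : seq (dart (Cay f))),
          simple_closed_path (L := Cay f) g c ->
          path_in (L := Cay f) (rho H @^-1` A) c ->
          exists (O : plane_graph R X) (l : vertex O -> G),
            [/\ disk_diagram O, van_kampen rels O, vertex_labeling f l,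
                boundary_eq l c & forall v, (rho H @^-1` B) (l v)]]) :
  finitely_presented H.
Proof.
have [B [_ finB fill]] := diagrams.
have [s sAB] : exists s : seq (set G), A `|` B = [set` s].
  by apply/finite_seqP; rewrite finite_setU.
have [rep repP] := coset_representative H.
have /choice[gpath gpathP] : forall y : 'I_(size s).+1 * X, exists p, A_path (f := f) H A rep (schreier_gen f H rep y) p.
  by move=> y; apply: A_path_exists => //; exact: schreier_gen_in.
(* Long enough for the relators of [G] lifted to the generators of [H], and for the
   expression of each generator as the label of a path. *)
pose N := (\max_y (size (gpath y)).+1 + \sum_(r <- rels) size r)%N.
pose srels := [seq u <- words_upto _ N | `[< weval (schreier_gen f H (s := s) rep) u = 1%g >]].
exists ('I_(size s).+1 * X)%type, (schreier_gen f H (s := s) rep), srels.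
have srelsP u : (size u <= N)%N -> weval (schreier_gen f H (s := s) rep) u = 1%g -> u \in srels.
  by move=> uN u1; rewrite mem_filter mem_words_upto// andbT; exact/asboolP.
apply: (schreier_presentation subH connA fill sAB repP _ _ gpathP).
- by move=> r; rewrite mem_filter => /andP[/asboolP].
- move=> r u rr ur; apply: srelsP; apply: (leq_trans ur).
  by rewrite (leq_trans _ (leq_addl _ _))// (big_rem r)//= leq_addr.
- move=> y; apply: srelsP; rewrite /= size_rev size_map.
  by rewrite (leq_trans _ (leq_addr _ _))// (leq_bigmax y).
Qed.
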